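(* Let $p>n$, let $\Omega\subset\mathbb{R}^n$ be an open, bounded, connected set with $C^{1,1}$ boundary, and let $F:\mathcal{S}\to\mathbb{R}$ be convex with $F(0)=0$ and satisfy $\mathcal{M}^-(M-N)\le F(M)-F(N)\le \mathcal{M}^+(M-N)$ for all $M,N\in\mathcal{S}$. Let $u$ be a $W^{2,p}$-viscosity solution of $$\begin{cases} F(D^2u(x))=-|\{y\in\Omega: u(y)\ge u(x)\}| & \text{in }\Omega,\\ u=0 & \text{on }\partial\Omega.\end{cases}$$ Suppose that $\Omega$ has a uniform inner ball condition: there is $\varepsilon_0>0$ such that for every $y\in\partial\Omega$ there exists a ball $B_\varepsilon\subset\Omega$ of radius $\varepsilon>\varepsilon_0$ with $y\in\partial B_\varepsilon$. Then there exist a constant $c_0>0$, with $c_0=c_0(\|u\|_{C^{1,\alpha}(\overline\Omega)})$, and a neighborhood $U$ of $\partial\Omega$ such that $|\nabla u|>c_0>0$ in $U\cap\Omega$.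
   Context: $\mathcal{S}$ is the set of real symmetric $n\times n$ matrices and $0<\lambda\le\Lambda$ are fixed ellipticity constants. The extremal Pucci operators are $\mathcal{M}^-(M)=\lambda\sum_{e_i>0}e_i+\Lambda\sum_{e_i<0}e_i$ and $\mathcal{M}^+(M)=\Lambda\sum_{e_i>0}e_i+\lambda\sum_{e_i<0}e_i$, where $e_i=e_i(M)$ are the eigenvalues of $M$. $|\cdot|$ applied to sets is $n$-dimensional Lebesgue measure. Here $\alpha\in(0,1)$ is an exponent for which $u\in C^{1,\alpha}(\overline\Omega)$ (with zero boundary data, solutions are in $C^{1,\alpha}(\overline\Omega)$ for every $\alpha<1$). $W^{2,p}$-viscosity solutions with a fixed right-hand side: let $f\in L^p(\Omega)$. A continuous function $u$ (on $\overline\Omega$) is a $W^{2,p}$-viscosity subsolution of $F(D^2u)=f$ in $\Omega$, $u=\psi$ on $\partial\Omega$, if $u\le\psi$ on $\partial\Omega$ and whenever $\varphi\in W^{2,p}(\Omega)$ and $u-\varphi$ has a local maximum at $x_0\in\Omega$, then $\operatorname{ess\,limsup}_{x\to x_0}\big(F(D^2\varphi(x))-f(x)\big)\ge 0$. It is a $W^{2,p}$-viscosity supersolution if $u\ge\psi$ on $\partial\Omega$ and whenever $\varphi\in W^{2,p}(\Omega)$ and $u-\varphi$ has a local minimum at $x_0\in\Omega$, then $\operatorname{ess\,liminf}_{x\to x_0}\big(F(D^2\varphi(x))-f(x)\big)\le 0$. It is a $W^{2,p}$-viscosity solution if it is both. A function $u$ is a $W^{2,p}$-viscosity solution of the nonlocal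 problem in the claim if it is a $W^{2,p}$-viscosity solution of $F(D^2u)=f$ in $\Omega$, $u=0$ on $\partial\Omega$, with $f(x)=-|\{y\in\Omega: u(y)\ge u(x)\}|$. *)

(* Defs.v *)
From HB Require Import structures.
From mathcomp Require Import all_boot all_order all_algebra.
From mathcomp Require Import all_classical all_reals all_analysis.
Set Implicit Arguments.
Unset Strict Implicit.
Unset Printing Implicit Defensive.
Import Order.TTheory GRing.Theory Num.Theory.
Import numFieldTopology.Exports numFieldNormedType.Exports.

Local Open Scope classical_set_scope.
Local Open Scope ring_scope.

(* Points of R^n are row vectors 'rV[R]_n. Their library norm is the sup norm,
   so it is used only for topological notions; enorm is the Euclidean norm. *)

Section euclidean.
Context {R : realType} {n : nat}.
Implicit Types (x y c : 'rV[R]_n) (u : 'rV[R]_n -> R).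

Definition enorm x : R := Num.sqrt (\sum_(i < n) x 0 i ^+ 2).

Definition eball c (r : R) : set 'rV[R]_n := [set x | enorm (x - c) < r].

Definition partial (i : 'I_n) u : 'rV[R]_n -> R :=
  fun x => 'D_(delta_mx 0 i) u x.

Definition grad u x : 'rV[R]_n := \row_i partial i u x.

Definition boundary (Om : set 'rV[R]_n) : set 'rV[R]_n :=
  closure Om `\` interior Om.

End euclidean.

(* The sigma-algebra of R^n generated by the coordinates, that is, the Borel
   sigma-algebra (same construction as the library's one on n.-tuple R). *)

Section measurable_rV.
Context {R : realType} {n : nat}.

Let coord : 'I_n -> 'rV[R]_n -> measurableTypeR R := fun i x => x 0 i.

Let rV_set0 : g_sigma_preimage coord set0.
Proof. exact: sigma_algebra0. Qed.

Let rV_setC A : g_sigma_preimage coord A -> g_sigma_preimage coord (~` A).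
Proof. exact: sigma_algebraC. Qed.

Let rV_bigcup (F : nat -> set 'rV[R]_n) :
  (forall i, g_sigma_preimage coord (F i)) ->
  g_sigma_preimage coord (\bigcup_i F i).
Proof. exact: sigma_algebra_bigcup. Qed.

HB.instance Definition _ := @isMeasurable.Build default_measure_display
  'rV[R]_n (g_sigma_preimage coord) rV_set0 rV_setC rV_bigcup.

End measurable_rV.

Section lebesgue_rV.
Context {R : realType}.

Lemma measurable_coord_rV n (i : 'I_n) :
  measurable_fun [set: 'rV[R]_n] (fun x => x 0 i : measurableTypeR R).
Proof.
move=> _ Y mY; rewrite setTI; apply: sub_sigma_algebra => /=.
rewrite -bigcup_seq/=; exists i => /=; first by rewrite mem_index_enum.
by exists Y => //; rewrite setTI.
Qed.

Lemma measurable_fun_rV d (T : measurableType d) n (f : T -> 'rV[R]_n) :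
  (forall i, measurable_fun [set: T] (fun t => f t 0 i : measurableTypeR R)) ->
  measurable_fun [set: T] f.
Proof.
move=> mf; apply: (@measurability _ _ _ _ _ _
  (\big[setU/set0]_(i < n) preimage_set_system setT
     (fun x : 'rV[R]_n => x 0 i : measurableTypeR R) measurable)) => //.
move=> _ [B + <-]; rewrite -bigcup_seq => -[i _ [Y mY <-]].
by rewrite !setTI; have := mf i measurableT Y mY; rewrite setTI.
Qed.

Definition cons_rV n (p : measurableTypeR R * 'rV[R]_n) : 'rV[R]_n.+1 :=
  \row_i oapp (p.2 0) p.1 (unlift ord0 i).

Definition uncons_rV n (v : 'rV[R]_n.+1) : measurableTypeR R * 'rV[R]_n :=
  (v 0 ord0, col' ord0 v).

Lemma uncons_rVK n : cancel (@uncons_rV n) (@cons_rV n).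
Proof.
move=> v; apply/rowP => i; rewrite !mxE /=.
by case: unliftP => [j|] -> //=; rewrite mxE.
Qed.

Lemma cons_rVK n : cancel (@cons_rV n) (@uncons_rV n).
Proof.
move=> [x v]; rewrite /uncons_rV; congr pair; first by rewrite mxE unlift_none.
by apply/rowP => j; rewrite !mxE liftK.
Qed.

Lemma measurable_cons_rV n : measurable_fun [set: _] (@cons_rV n).
Proof.
apply: measurable_fun_rV => i; under eq_fun do rewrite mxE.
case: (unliftP ord0 i) => [j|] _ /=; last exact: measurable_fst.
exact: (measurableT_comp (measurable_coord_rV j) measurable_snd).
Qed.

Lemma measurable_uncons_rV n : measurable_fun [set: _] (@uncons_rV n).
Proof.
apply/measurable_fun_pairP; split; first exact: measurable_coord_rV.
apply: measurable_fun_rV => i; under eq_fun do rewrite /= mxE.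
exact: measurable_coord_rV.
Qed.

Section step.
Variables (n : nat) (mu : {sigma_finite_measure set 'rV[R]_n -> \bar R}).

Definition lebesgue_rV_step : set 'rV[R]_n.+1 -> \bar R :=
  pushforward (@lebesgue_measure R \x mu)%E (@cons_rV n).

Let step0 : lebesgue_rV_step set0 = 0%E.
Proof. by rewrite /lebesgue_rV_step /pushforward preimage_set0 measure0. Qed.

Let step_ge0 A : (0 <= lebesgue_rV_step A)%E.
Proof. by rewrite /lebesgue_rV_step /pushforward measure_ge0. Qed.

Let step_sigma_additive : semi_sigma_additive lebesgue_rV_step.
Proof.
have mc := @measurable_cons_rV n.
move=> F mF tF mUF; rewrite /lebesgue_rV_step /pushforward preimage_bigcup.
apply: measure_semi_sigma_additive.
- by move=> k; rewrite -[X in measurable X]setTI; exact: mc.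
- apply/trivIsetP => /= i j _ _ ij; rewrite -preimage_setI.
  by move/trivIsetP : tF => /(_ _ _ _ _ ij) ->//; rewrite preimage_set0.
- by rewrite -preimage_bigcup -[X in measurable X]setTI; exact: mc.
Qed.

HB.instance Definition _ := isMeasure.Build _ _ _ lebesgue_rV_step
  step0 step_ge0 step_sigma_additive.

Let step_sigma_finite : sigma_finite setT lebesgue_rV_step.
Proof.
have /sigma_finiteP[F [TF ndF Foo]] := sigma_finiteT (@lebesgue_measure R).
have /sigma_finiteP[G [TG ndG Goo]] := sigma_finiteT mu.
exists (fun k => @uncons_rV n @^-1` (F k `*` G k)).
  apply/esym; rewrite -subTset => v _.
  have [i _ Fi] : (\bigcup_i F i) (v 0 ord0) by rewrite -TF.
  have [j _ Gj] : (\bigcup_i G i) (col' ord0 v) by rewrite -TG.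
  exists (maxn i j) => //; split => /=.
  - by move: Fi; exact/subsetPset/ndF/leq_maxl.
  - by move: Gj; exact/subsetPset/ndG/leq_maxr.
move=> k; have [mF Fk] := Foo k; have [mG Gk] := Goo k; split.
  rewrite -[X in measurable X]setTI; apply: measurable_uncons_rV => //.
  exact: measurableX.
rewrite /lebesgue_rV_step /pushforward -comp_preimage.
rewrite (_ : _ \o _ = id); last by apply/funext => p; exact: cons_rVK.
by rewrite preimage_id product_measure1E// lte_mul_pinfty// ge0_fin_numE.
Qed.

HB.instance Definition _ := Measure_isSigmaFinite.Build _ _ _ lebesgue_rV_step
  step_sigma_finite.

End step.

Fixpoint lebesgue_rV (n : nat) : {sigma_finite_measure set 'rV[R]_n -> \bar R} :=
  match n with
  | 0 => (\d_(0 : 'rV[R]_0))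
  | n'.+1 => lebesgue_rV_step (lebesgue_rV n')
  end.

End lebesgue_rV.

Section sobolev.
Context {R : realType} {n : nat}.
Implicit Types (Om : set 'rV[R]_n) (p : R) (f g phi psi : 'rV[R]_n -> R).

Definition smooth psi : Prop :=
  forall (s : seq 'I_n) x, differentiable (foldr partial psi s) x.

Definition test_function Om psi : Prop :=
  smooth psi /\ exists K : set 'rV[R]_n,
    [/\ compact K, K `<=` Om & forall x, ~ K x -> psi x = 0].

Definition Lp Om p f : Prop :=
  measurable_fun Om f /\
  (\int[lebesgue_rV n]_(x in Om) (`|f x| `^ p)%:E < +oo)%E.

Definition weak_partial Om (s : seq 'I_n) f g : Prop :=
  forall psi, test_function Om psi ->
    \int[lebesgue_rV n]_(x in Om) (f x * foldr partial psi s x) =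
    (-1) ^+ size s * \int[lebesgue_rV n]_(x in Om) (g x * psi x).

Definition W2p Om p phi : Prop :=
  Lp Om p phi /\
  forall s : seq 'I_n, (1 <= size s <= 2)%N ->
    exists2 g, Lp Om p g & weak_partial Om s phi g.

(* H is a representative, with symmetric values, of D^2 phi. *)
Definition weak_hessian Om p phi (H : 'rV[R]_n -> 'M[R]_n) : Prop :=
  (forall x, Om x -> (H x)^T = H x) /\
  forall i j, Lp Om p (fun x => H x i j) /\
    weak_partial Om [:: i; j] phi (fun x => H x i j).

Definition ess_sup_on (A : set 'rV[R]_n) g : \bar R :=
  ereal_inf [set y | {ae lebesgue_rV n, forall x, A x -> ((g x)%:E <= y)%E}].

Definition ess_inf_on (A : set 'rV[R]_n) g : \bar R :=
  ereal_sup [set y | {ae lebesgue_rV n, forall x, A x -> (y <= (g x)%:E)%E}].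

Definition ess_limsup Om g (x0 : 'rV[R]_n) : \bar R :=
  ereal_inf [set ess_sup_on (Om `&` eball x0 r) g | r in [set r : R | 0 < r]].

Definition ess_liminf Om g (x0 : 'rV[R]_n) : \bar R :=
  ereal_sup [set ess_inf_on (Om `&` eball x0 r) g | r in [set r : R | 0 < r]].

End sobolev.

Section pucci.
Context {R : realType} {n : nat}.
Implicit Types (M N : 'M[R]_n) (F : 'M[R]_n -> R).

(* Sum of the eigenvalues of M satisfying P, counted with multiplicity. The
   index set is finite, so the sum over it is the usual one. *)
Definition eigen_sum (P : R -> bool) M : R :=
  \sum_(e \in [set e : R | eigenvalue M e && P e]) e *+ mup e (char_poly M).

Definition pucci_min (lam Lam : R) M : R :=
  lam * eigen_sum (fun e => 0 < e) M + Lam * eigen_sum (fun e => e < 0) M.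

Definition pucci_max (lam Lam : R) M : R :=
  Lam * eigen_sum (fun e => 0 < e) M + lam * eigen_sum (fun e => e < 0) M.

(* An operator on symmetric matrices is a function on all square matrices whose
   values off the symmetric ones are irrelevant. *)
Definition uniformly_elliptic (lam Lam : R) F : Prop :=
  forall M N, M^T = M -> N^T = N ->
    pucci_min lam Lam (M - N) <= F M - F N <= pucci_max lam Lam (M - N).

Definition convex_sym F : Prop :=
  forall M N (t : R), M^T = M -> N^T = N -> 0 <= t <= 1 ->
    F (t *: M + (1 - t) *: N) <= t * F M + (1 - t) * F N.

End pucci.

Section viscosity.
Context {R : realType} {n : nat}.
Variables (Om : set 'rV[R]_n) (p : R) (F : 'M[R]_n -> R).
Implicit Types f psi u phi : 'rV[R]_n -> R.

(* For p > n every class in W^{2,p} has a unique continuous representative; the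
   pointwise conditions on phi refer to it. *)
Definition visc_subsolution f psi u : Prop :=
  [/\ {within closure Om, continuous u},
      forall x, boundary Om x -> u x <= psi x &
      forall phi H x0, W2p Om p phi -> {within Om, continuous phi} ->
        weak_hessian Om p phi H -> Om x0 ->
        (\forall x \near x0, u x - phi x <= u x0 - phi x0) ->
        (0 <= ess_limsup Om (fun x => (F (H x) - f x)%R) x0)%E].

Definition visc_supersolution f psi u : Prop :=
  [/\ {within closure Om, continuous u},
      forall x, boundary Om x -> psi x <= u x &
      forall phi H x0, W2p Om p phi -> {within Om, continuous phi} ->
        weak_hessian Om p phi H -> Om x0 ->
        (\forall x \near x0, u x0 - phi x0 <= u x - phi x) ->
        (ess_liminf Om (fun x => (F (H x) - f x)%R) x0 <= 0)%E].

Definition visc_solution f psi u : Prop :=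
  visc_subsolution f psi u /\ visc_supersolution f psi u.

Definition superlevel_rhs u : 'rV[R]_n -> R :=
  fun x => - fine (lebesgue_rV n [set y | Om y /\ u x <= u y]).

Definition nonlocal_solution u : Prop :=
  visc_solution (superlevel_rhs u) (fun=> 0) u.

End viscosity.

Section regularity.
Context {R : realType}.

Definition C1alpha_norm n (Om : set 'rV[R]_n) (a : R) (u : 'rV[R]_n -> R) :
    \bar R :=
  (ereal_sup [set `|u x|%:E | x in Om]
   + ereal_sup [set (enorm (grad u x))%:E | x in Om]
   + ereal_sup [set (enorm (grad u z.1 - grad u z.2)
                     / enorm (z.1 - z.2) `^ a)%:E
       | z in [set z | [/\ Om z.1, Om z.2 & z.1 != z.2]]])%E.

(* C^{1,a}(closure Om): C^1 in Om, with u and its gradient extending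
   continuously to the closure, and finite norm. *)
Definition C1alpha n (Om : set 'rV[R]_n) (a : R) (u : 'rV[R]_n -> R) : Prop :=
  [/\ {within closure Om, continuous u},
      forall x, Om x -> differentiable u x,
      exists2 G : 'rV[R]_n -> 'rV[R]_n, {within closure Om, continuous G} &
        forall x, Om x -> G x = grad u x &
      (C1alpha_norm Om a u < +oo)%E].

Definition C11 m (gam : 'rV[R]_m -> R) : Prop :=
  (forall y, differentiable gam y) /\
  exists L : R, forall y z,
    enorm (grad gam y - grad gam z) <= L * enorm (y - z).

(* Near each boundary point, after the orthogonal change of axes x |-> x *m Q,
   Om is the region above the graph of a C^{1,1} function of the last n
   coordinates. *)
Definition C11_boundary n (Om : set 'rV[R]_n.+1) : Prop :=
  forall x0, boundary Om x0 ->
    exists (Q : 'M[R]_n.+1) (r : R) (gam : 'rV[R]_n -> R),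
      [/\ Q *m Q^T = 1%:M, 0 < r, C11 gam &
          forall x, eball x0 r x ->
            (Om x <-> gam (col' ord0 (x *m Q)) < (x *m Q) 0 ord0)].

Definition uniform_inner_ball n (Om : set 'rV[R]_n) : Prop :=
  exists2 e0 : R, 0 < e0 & forall y, boundary Om y ->
    exists (c : 'rV[R]_n) (e : R),
      [/\ e0 < e, eball c e `<=` Om & boundary (eball c e) y].

End regularity.

(* Main.v *)
(* Put N = n+1 for the dimension.  If a paraboloid with Hessian -2A touches u from
   below at x0, then |{u >= u(x)}| <= 2 A Lam N for x near x0.  With A = 0 this
   rules out interior local minima, so u >= 0, and points that are not maximum
   points of u are dense.
   Let B(c, r) be a ball in Om and phi(x) = a (r^(2N+2) - |x - c|^(2N+2)).  If
   u - phi has a negative minimum over the ball at x0, then u > u(x0) on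
   B(c, |x0 - c|), a set of measure of order |x0 - c|^N, whereas D^2 phi(x0) is of
   order a |x0 - c|^(2N): for a small depending only on N and Lam this forces
   x0 = c, and then c is a maximum point of u.  Approximating c by points that are
   not, u >= phi on every inner ball of radius at most 1.  At a boundary point the
   barrier has a fixed slope, and the mean value theorem together with the
   continuity of the gradient up to the boundary concludes. *)

Require Import Defs.
From HB Require Import structures.
From mathcomp Require Import all_boot all_order all_algebra.
From mathcomp Require Import all_classical all_reals all_analysis.
From mathcomp Require Import measurable_realfun ring lra.
Import Order.TTheory GRing.Theory Num.Theory.
Import numFieldTopology.Exports numFieldNormedType.Exports.
Local Open Scope classical_set_scope.
Local Open Scope ring_scope.

(** * Lebesgue measure on row vectors *)

(** The sup-norm ball in coordinate form, which makes it a finite intersection of coordinate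
    preimages and, under [cons_rV], a product of an interval with a lower-dimensional box. *)
Definition box {R : realType} {n : nat} (c : 'rV[R]_n) (r : R) : set 'rV[R]_n :=
  [set x | forall i, `|x 0 i - c 0 i| < r].

Lemma box_ball {R : realType} {n : nat} (c : 'rV[R]_n) (r : R) :
  0 < r -> box c r = ball c r.
Proof.
move=> r0; apply/seteqP; split=> x; rewrite /box /ball /= /mx_ball /=.
  by move=> h; split=> // i j; rewrite ord1 /ball /= distrC.
by move=> [_ h] i; rewrite distrC; exact: (h ord0 i).
Qed.

Lemma measurable_box {R : realType} {n : nat} (c : 'rV[R]_n) (r : R) :
  measurable (box c r).
Proof.
have -> : box c r =
    \bigcap_(i in [set: 'I_n]) ((fun x : 'rV[R]_n => x 0 i : measurableTypeR R)
                   @^-1` (ball (c 0 i) r)).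
  apply/seteqP; split=> x; first by move=> h i _; rewrite /= /ball /= distrC.
  by move=> h i; have := h i I; rewrite /= /ball /= distrC.
apply: fin_bigcap_measurable => // i _.
rewrite -[X in measurable X]setTI; apply: measurable_coord_rV => //.
by rewrite ball_itv; exact: measurable_itv.
Qed.

(** The sigma-algebra is generated by coordinates, so an open set is exhibited as the countable
    union of the rational boxes that it contains. *)
Lemma measurable_open_rV {R : realType} {n : nat} (U : set 'rV[R]_n) :
  open U -> measurable U.
Proof.
move=> oU.
pose B (q : 'rV[rat]_n * rat) : set 'rV[R]_n :=
  box (map_mx ratr q.1) (ratr q.2).
have -> : U = \bigcup_q if pselect (B q `<=` U) then B q else set0.
  apply/seteqP; split=> [x Ux|x [q _]]; last first.
    by case: pselect => // Bq; exact: Bq.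
  have /nbhs_ballP[e /= e0 eU] : nbhs x U by exact: open_nbhs_nbhs.
  (* A rational radius [s < e / 2] and a rational center within [s] of [x]: the box then contains
     [x] and stays in the ball of radius [e]. *)
  have [s] := @rat_in_itvoo R 0 (e / 2) (divr_gt0 e0 (ltr0n _ 2)).
  rewrite in_itv /= => /andP[s0 se].
  have /choice[c hc] : forall i, exists q : rat, `|ratr q - x 0 i| < ratr s.
    move=> i; have [|q] := @rat_in_itvoo R (x 0 i - ratr s) (x 0 i + ratr s).
      by rewrite ltrD2l gt0_cp.
    by rewrite in_itv /= => h; exists q; rewrite ltr_distl.
  have BU : B (\row_i c i, s) `<=` U.
    move=> y By; apply: eU; rewrite -box_ball // => i.
    have := By i; rewrite !mxE => h.
    rewrite (le_lt_trans (ler_distD (ratr (c i)) _ _)) // (splitr e).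
    by rewrite ltrD // (lt_trans _ se).
  exists (\row_i c i, s) => //; rewrite /=; case: pselect => // ?.
  by move=> i; rewrite !mxE distrC.
apply: countable_bigcupT_measurable => // q.
by case: pselect => ?; [exact: measurable_box|exact: measurable0].
Qed.

Lemma measurable_continuous_rV {R : realType} {n : nat} (f : 'rV[R]_n -> R) :
  continuous f -> measurable_fun setT f.
Proof.
move=> /continuousP cf; apply: (measurability _ (RGenOpens.measurableE R)).
move=> _ [_ [a [b ->] <-]]; rewrite setTI; apply: measurable_open_rV.
exact/cf/interval_open.
Qed.

(** Induction along the product construction of the measure. In dimension 0 the measure is the Dirac
    mass at the only point, in agreement with the empty power. *)
Lemma lebesgue_rV_box {R : realType} {n : nat} (c : 'rV[R]_n) (r : R) :
  0 < r -> lebesgue_rV n (box c r) = ((2 * r) ^+ n)%:E.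
Proof.
move=> r0; elim: n c => [|n IH] c.
  by rewrite /= diracE mem_set // => -[].
rewrite /= /lebesgue_rV_step /pushforward.
have -> : @cons_rV R n @^-1` box c r = ball (c 0 ord0) r `*` box (col' ord0 c) r.
  apply/seteqP; split=> -[x v] /=.
    move=> h; split.
      by have := h ord0; rewrite !mxE unlift_none /= /ball /= distrC.
    by move=> i; have := h (lift ord0 i); rewrite !mxE liftK.
  move=> [h1 h2] i; rewrite !mxE; case: unliftP => [j|] -> /=.
    by have := h2 j; rewrite !mxE.
  by move: h1; rewrite /ball /= distrC.
rewrite product_measure1E //; last exact: measurable_box; last by rewrite ball_itv; exact: measurable_itv.
rewrite [X in (_ * X)%E = _]IH exprS EFinM mulr_natl; congr (_ * _)%E.
exact: lebesgue_measure_ball (ltW r0).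
Qed.

Lemma lebesgue_rV_bounded_lty {R : realType} {n : nat} (A : set 'rV[R]_n) :
  measurable A -> bounded_set A -> (lebesgue_rV n A < +oo)%E.
Proof.
move=> mA /ex_strict_bound_gt0[M M0 AM].
apply: (@le_lt_trans _ _ (lebesgue_rV n (box 0 M))); last first.
  by rewrite lebesgue_rV_box // ltry.
apply: le_measure; rewrite ?inE //; first exact: measurable_box.
rewrite box_ball // => x /AM /=.
by rewrite -ball_normE /= sub0r normrN.
Qed.

(** * Integration by parts *)

Lemma closed_sublevel {R : realType} {T : topologicalType} (f : T -> R) (c : R) :
  continuous f -> closed [set x | f x <= c].
Proof. by move=> cf; apply: (preimage_closed (f := f)) (@closed_le R c) => x _; exact: cf. Qed.

Lemma compact_norm_le {R : realType} {n : nat} (L : R) :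
  compact [set x : 'rV[R]_n | `|x| <= L].
Proof.
apply: bounded_closed_compact.
  exists L; split; first exact: num_real.
  by move=> M LM x /= /le_trans; apply; exact: ltW.
by apply: closed_sublevel => x; exact: norm_continuous.
Qed.

Lemma continuous_bounded_on {R : realType} {n : nat} (f : 'rV[R]_n -> R)
    (A : set 'rV[R]_n) : continuous f -> bounded_set A ->
  exists M : R, forall x, A x -> `|f x| <= M.
Proof.
move=> cf /ex_strict_bound_gt0[L L0 AL].
have /ex_strict_bound_gt0[M _ hM] := compact_bounded
  (continuous_compact (continuous_subspaceT cf) (compact_norm_le L)).
by exists M => x /AL /ltW xL; apply/ltW/hM; exists x.
Qed.

Lemma integrable_continuous_box {R : realType} {n : nat} (g : 'rV[R]_n -> R)
    (L : R) : 0 < L -> continuous g -> (forall x, ~ box 0 L x -> g x = 0) ->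
  (lebesgue_rV n).-integrable setT (EFin \o g).
Proof.
move=> L0 cg g0.
have -> : EFin \o g = (EFin \o g) \_ (box 0 L).
  apply/funext => x; rewrite patchE; case: ifPn => // /negP.
  by rewrite inE /= => /g0 ->.
apply: (iffLR (integrable_mkcond (EFin \o g) (measurable_box 0 L))).
apply: measurable_bounded_integrable; first exact: measurable_box.
- by rewrite /= lebesgue_rV_box // ltry.
- by apply: measurable_funTS; exact: measurable_continuous_rV.
have bB : bounded_set (box 0 L : set 'rV[R]_n).
  exists L; split; first exact: num_real.
  move=> M LM x; rewrite box_ball // -ball_normE /= sub0r normrN => xL.
  exact/ltW/(lt_trans xL).
have [M hM] := continuous_bounded_on g _ cg bB.
exists M; split; first exact: num_real.
by move=> N MN x /hM /le_trans; apply; exact: ltW.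
Qed.

(** The fundamental theorem of calculus on [[- L, L]], at whose end points [h] vanishes. *)
Lemma integral_derive_eq0 {R : realType} (h h' : R -> R) (L : R) :
  0 < L -> continuous h' -> (forall t : R, is_derive t 1 h (h' t)) ->
  (forall t, L <= `|t| -> h t = 0 /\ h' t = 0) ->
  (\int[lebesgue_measure]_t (h' t)%:E = 0)%E.
Proof.
move=> L0 ch' dh h0.
have -> : (fun t => (h' t)%:E) = (EFin \o h') \_ `[- L, L].
  apply/funext => t; rewrite patchE; case: ifPn => // /negP.
  rewrite inE /= in_itv /= -ler_norml => /negP.
  by rewrite -ltNge => /ltW /h0[_ ->].
rewrite -integral_mkcond (@continuous_FTC2 _ h' h).
- by rewrite !(h0 _ _).1 ?subee // ?normrN ger0_norm // ltW.
- by rewrite -subr_gt0 opprK addr_gt0.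
- exact: continuous_subspaceT.
- have ch : continuous h.
    by move=> t; apply/differentiable_continuous/derivable1_diffP/ex_derive.
  split; first by move=> t _; exact: ex_derive.
  - exact/cvg_at_right_filter/ch.
  - exact/cvg_at_left_filter/ch.
- by move=> t _; rewrite derive1E derive_val.
Qed.

Lemma cons_rV_delta0 {R : realType} {n : nat} (t s : R) (v : 'rV[R]_n) :
  cons_rV (t + s, v) = t *: delta_mx 0 ord0 + cons_rV (s, v).
Proof.
apply/rowP => i; rewrite !mxE; case: unliftP => [j|] -> /=.
  by rewrite mulr0 add0r.
by rewrite mulr1.
Qed.

Lemma cons_rV_delta {R : realType} {n : nat} (t s : R) (v : 'rV[R]_n) (j : 'I_n) :
  cons_rV (s, t *: delta_mx 0 j + v) = t *: delta_mx 0 (lift ord0 j) + cons_rV (s, v).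
Proof.
apply/rowP => i; rewrite !mxE; case: unliftP => [k|] -> /=.
  by rewrite !mxE (inj_eq lift_inj).
by rewrite mulr0 add0r.
Qed.

Lemma continuous_consr {R : realType} {n : nat} (s : R) :
  continuous (fun v : 'rV[R]_n => cons_rV (s, v)).
Proof.
move=> v A [P hP PA]; exists (fun i j => P i (lift ord0 j)) => [i j|w Pw].
  by have := hP i (lift ord0 j); rewrite (ord1 i) !mxE liftK.
apply: PA => i j; rewrite (ord1 i) !mxE; case: (unliftP ord0 j) => [k|] -> /=.
  exact: Pw.
by have := nbhs_singleton (hP 0 ord0); rewrite !mxE unlift_none.
Qed.

Lemma continuous_consl {R : realType} {n : nat} (v : 'rV[R]_n) :
  continuous (fun s : R => cons_rV (s, v)).
Proof.
move=> s A [P hP PA].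
have h0 : nbhs s (P 0 ord0) by have := hP 0 ord0; rewrite !mxE unlift_none.
apply: filterS h0 => t Pt; apply: PA => i j; rewrite !mxE.
case: (unliftP ord0 j) => [k|] -> /=; last by rewrite (ord1 i).
by have := nbhs_singleton (hP i (lift ord0 k)); rewrite !mxE liftK.
Qed.

(** The hypothesis on [T] makes the difference quotients of [f \o T] along [e] and of [f] along [v]
    literally equal. *)
Lemma is_derive_affine_comp {R : realType} {V W : normedModType R}
    (f : V -> R) (T : W -> V) (a e : W) (v : V) (df : R) :
  (forall h : R, T (h *: e + a) = h *: v + T a) ->
  is_derive (T a) v f df -> is_derive a e (f \o T) df.
Proof.
move=> hT [d1 <-].
have E : (fun h : R => h^-1 *: ((f \o shift (T a)) (h *: v) - f (T a))) =
    (fun h : R => h^-1 *: (((f \o T) \o shift a) (h *: e) - (f \o T) a)).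
  by apply/funext => h /=; rewrite hT.
by split; [move: d1; rewrite /derivable E|rewrite /derive E].
Qed.

(** Fubini, integrating first over a group of coordinates that contains the differentiated one: the
    inner integral is already zero. *)
Lemma integral_partial_eq0 {R : realType} {n : nat} (i : 'I_n)
    (eta g : 'rV[R]_n -> R) (L : R) :
  0 < L -> continuous g -> (forall x, is_derive x (delta_mx 0 i) eta (g x)) ->
  (forall x, ~ box 0 L x -> eta x = 0 /\ g x = 0) ->
  (\int[lebesgue_rV n]_x (g x)%:E = 0)%E.
Proof.
elim: n i eta g => [[]//|n IH] i eta g L0 cg dg g0.
have mc := @measurable_cons_rV R n.
have mg : measurable_fun setT (EFin \o g).
  by apply/measurable_EFinP; exact: measurable_continuous_rV.
have /integrableP[_ ig] := integrable_continuous_box g L L0 cg (fun x h => (g0 x h).2).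
have ic : (lebesgue_measure \x lebesgue_rV n)%E.-integrable setT
    ((EFin \o g) \o @cons_rV R n).
  apply/integrableP; split; first exact: measurableT_comp.
  move: ig; rewrite /= /lebesgue_rV_step ge0_integral_pushforward //.
  apply/measurable_EFinP; apply: measurableT_comp => //.
  exact: measurable_continuous_rV.
rewrite /= /lebesgue_rV_step integral_pushforward // preimage_setT.
case: (unliftP ord0 i) => [j|] ij.
(* The direction lies among the last coordinates: freeze the first one and use induction on the
   dimension. *)
- rewrite -integral12_prod_meas1 // /fubini_F integral0_eq // => s _.
  apply: (IH j (fun v => eta (cons_rV (s, v))) (fun v => g (cons_rV (s, v)))) => //.
  + move=> v; apply: (@continuous_comp _ _ _ (fun v => cons_rV (s, v)) g); last exact: cg.
    exact: continuous_consr.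
  + move=> v; apply: (is_derive_affine_comp _ (fun v => cons_rV (s, v))) (dg _).
    by move=> h; rewrite cons_rV_delta ij.
  + move=> v vL; apply: g0; apply: contra_not vL => h k.
    by have := h (lift ord0 k); rewrite !mxE liftK.
(* The direction is the first coordinate: freeze the others and use the one-dimensional case. *)
- rewrite -integral21_prod_meas1 // /fubini_G integral0_eq // => v _.
  apply: (integral_derive_eq0 (fun s => eta (cons_rV (s, v))) _ L) => //.
  + move=> s; apply: (@continuous_comp _ _ _ (fun s => cons_rV (s, v)) g); last exact: cg.
    exact: continuous_consl.
  + move=> s; apply: (is_derive_affine_comp _ (fun s => cons_rV (s, v))) (dg _).
    by move=> h; rewrite cons_rV_delta0 ij scaler1.
  + move=> s sL; apply: g0 => h; have := h ord0.
    by rewrite !mxE unlift_none /= subr0 ltNge sL.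
Qed.

(** * Quadratic test functions *)

Lemma continuous_fctM {R : realType} {T : topologicalType} {f g : T -> R} :
  continuous f -> continuous g -> continuous (fun x => f x * g x).
Proof. by move=> cf cg x; exact: (cvgM (cf x) (cg x)). Qed.

Lemma continuous_fctD {R : realType} {T : topologicalType} {f g : T -> R} :
  continuous f -> continuous g -> continuous (fun x => f x + g x).
Proof. by move=> cf cg x; exact: (cvgD (cf x) (cg x)). Qed.

Lemma continuous_fctB {R : realType} {T : topologicalType} {f g : T -> R} :
  continuous f -> continuous g -> continuous (fun x => f x - g x).
Proof. by move=> cf cg x; exact: (cvgB (cf x) (cg x)). Qed.

Lemma continuous_fctX {R : realType} {T : topologicalType} {f : T -> R} (k : nat) :
  continuous f -> continuous (fun x => f x ^+ k).
Proof.
move=> cf x; apply: (@continuous_comp _ _ _ f (fun y : R => y ^+ k)); first exact: cf.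
exact: exprn_continuous.
Qed.

Section quadratic_test_functions.
Context {R : realType} {n : nat}.
Implicit Types (Om : set 'rV[R]_n) (f g psi : 'rV[R]_n -> R) (i j : 'I_n).

Lemma Lp_continuous Om (p : R) f : 0 <= p -> measurable Om -> bounded_set Om ->
  continuous f -> Lp Om p f.
Proof.
move=> p0 mOm bOm cf; have mf := measurable_continuous_rV f cf.
have mfOm : measurable_fun Om f by exact: measurable_funTS mf.
split=> //; have [M hM] := continuous_bounded_on f Om cf bOm.
have mP : measurable_fun Om (fun x => (`|f x| `^ p)%:E).
  apply/measurable_EFinP.
  apply: (measurableT_comp (f := fun y : R => y `^ p)); first exact: measurable_powR.
  exact: measurableT_comp.
apply: (@le_lt_trans _ _ (\int[lebesgue_rV n]_(x in Om) `|(`|f x| `^ p)%:E|)%E).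
  by apply: ge0_le_integral => //; [apply: measurableT_comp|move=> x _; exact: lee_abs].
apply: (@le_lt_trans _ _ ((`|M| `^ p)%:E * lebesgue_rV n Om)%E).
  apply: integral_le_bound => //.
  apply: aeW => x Omx; rewrite lee_fin ger0_norm ?powR_ge0 //.
  by apply: ge0_ler_powR; rewrite ?nnegrE ?normr_ge0 // (le_trans (hM _ Omx)) // ler_norm.
by rewrite lte_mul_pinfty // ?lee_fin ?powR_ge0 // lebesgue_rV_bounded_lty.
Qed.

Lemma partial_eq0_outside (K : set 'rV[R]_n) psi i : compact K ->
  (forall x, ~ K x -> psi x = 0) -> forall x, ~ K x -> partial i psi x = 0.
Proof.
move=> cK h x Kx.
have oK : open (~` K) by apply: closed_openC; apply: compact_closed.
rewrite /partial (@near_eq_derive _ _ _ psi (cst 0)) ?derive_cst //.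
by apply: filterS (open_nbhs_nbhs (conj oK Kx)) => y /h.
Qed.

Lemma test_function_partial Om psi i :
  test_function Om psi -> test_function Om (partial i psi).
Proof.
move=> [sm [K [cK KOm h]]]; split.
  by move=> s x; rewrite -foldr_rcons; exact: sm.
by exists K; split=> //; exact: partial_eq0_outside.
Qed.

Lemma Rintegral_supported Om g :
  (forall x, ~ Om x -> g x = 0) ->
  \int[lebesgue_rV n]_(x in Om) g x = \int[lebesgue_rV n]_x g x.
Proof.
move=> g0; rewrite Rintegral_mkcond; apply: eq_Rintegral => x _.
by rewrite patchE; case: ifPn => // /negP; rewrite inE => /g0.
Qed.

(** The support of [psi] is compact in [Om], so both integrals extend to the whole space, where the
    derivative of [q * psi] has integral zero. *)
Lemma Rintegral_by_parts Om psi i (q dq : 'rV[R]_n -> R) : test_function Om psi ->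
  continuous q -> continuous dq -> (forall x, is_derive x (delta_mx 0 i) q (dq x)) ->
  \int[lebesgue_rV n]_(x in Om) (q x * partial i psi x) =
  - \int[lebesgue_rV n]_(x in Om) (dq x * psi x).
Proof.
move=> tpsi cq cdq dqP; have [sm [K [cK KOm psi0]]] := tpsi.
have [smi [_ _]] := test_function_partial _ _ i tpsi.
have dpsi0 := partial_eq0_outside K psi i cK psi0.
have cpsi : continuous psi by move=> x; exact/differentiable_continuous/(sm [::]).
have cdpsi : continuous (partial i psi).
  by move=> x; exact/differentiable_continuous/(smi [::]).
have [L L0 KL] : exists2 L : R, 0 < L & K `<=` box 0 L.
  have [L L0 hL] := ex_strict_bound_gt0 (compact_bounded cK).
  exists L => // x /hL; rewrite box_ball // -ball_normE /= sub0r normrN.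
  exact.
have out (x : 'rV[R]_n) : ~ box 0 L x -> ~ K x by apply: contra_not => /KL.
have nOm (x : 'rV[R]_n) : ~ Om x -> ~ K x by apply: contra_not => /KOm.
rewrite (Rintegral_supported Om (fun x => q x * partial i psi x)); last first.
  by move=> x /nOm/dpsi0 ->; rewrite mulr0.
rewrite (Rintegral_supported Om (fun x => dq x * psi x)); last first.
  by move=> x /nOm/psi0 ->; rewrite mulr0.
have i1 : (lebesgue_rV n).-integrable setT (EFin \o (fun x => q x * partial i psi x)).
  apply: (integrable_continuous_box _ L) => //; first exact: continuous_fctM.
  by move=> x /out/dpsi0 ->; rewrite mulr0.
have i2 : (lebesgue_rV n).-integrable setT (EFin \o (fun x => dq x * psi x)).
  apply: (integrable_continuous_box _ L) => //; first exact: continuous_fctM.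
  by move=> x /out/psi0 ->; rewrite mulr0.
apply/eqP; rewrite -addr_eq0 -RintegralD //; apply/eqP.
rewrite /Rintegral; apply: (congr1 fine (y := 0%E)).
apply: (@integral_partial_eq0 R n i (q * psi) _ L) => //.
- by apply: continuous_fctD; exact: continuous_fctM.
- move=> x; have dpsi : is_derive x (delta_mx 0 i) psi (partial i psi x).
    by apply/derivableP/diff_derivable/(sm [::]).
  have := is_deriveM (dqP x) dpsi.
  by congr (is_derive _ _ _ _); rewrite /GRing.scale /= [psi x * _]mulrC.
- move=> x /out xK; rewrite mulrfctE psi0 // dpsi0 // !mulr0 addr0.
  by split.
Qed.

(** A paraboloid with Hessian [- (A * 2)] times the identity, without constant term: only
    differences of values matter when it touches [u]. *)
Definition quadratic (b : 'rV[R]_n) (A : R) : 'rV[R]_n -> R :=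
  fun x => \sum_(i < n) (b 0 i * x 0 i - A * x 0 i ^+ 2).

Lemma continuous_coord i : continuous (fun x : 'rV[R]_n => x 0 i).
Proof. exact: coord_continuous. Qed.

Lemma continuous_affine_coord (c a k : R) i :
  continuous (fun x : 'rV[R]_n => c - a * (k * x 0 i)).
Proof.
apply: continuous_fctB; first exact: cst_continuous.
apply: continuous_fctM; first exact: cst_continuous.
apply: continuous_fctM; first exact: cst_continuous.
exact: continuous_coord.
Qed.

Lemma continuous_quadratic b A : continuous (quadratic b A).
Proof.
have -> : quadratic b A =
    \sum_(i < n) (fun x => b 0 i * x 0 i - A * x 0 i ^+ 2).
  by apply/funext => x; rewrite fct_sumE.
elim/big_ind: _ => [|f g cf cg|i _].
- exact: cst_continuous.
- exact: continuous_fctD.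
- apply: continuous_fctB; apply: continuous_fctM.
  + exact: cst_continuous.
  + exact: continuous_coord.
  + exact: cst_continuous.
  + by apply: continuous_fctM; exact: continuous_coord.
Qed.

Lemma is_derive_coord i j x :
  is_derive x (delta_mx 0 i) (fun y : 'rV[R]_n => y 0 j) (i == j)%:R.
Proof.
apply: (is_derive_affine_comp id _ _ _ (i == j)%:R).
by move=> h; rewrite !mxE eqxx eq_sym.
Qed.

Lemma is_derive_quadratic b A i x :
  is_derive x (delta_mx 0 i) (quadratic b A) (b 0 i - A * (2 * x 0 i)).
Proof.
pose h (j : 'I_n) : 'rV[R]_n -> R :=
  (b 0 j \*: (fun y : 'rV[R]_n => y 0 j)) - (A \*: ((fun y : 'rV[R]_n => y 0 j) ^+ 2)).
have -> : quadratic b A = \sum_(j < n) h j.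
  by apply/funext => y; rewrite fct_sumE.
have dh j : is_derive x (delta_mx 0 i) (h j)
    ((i == j)%:R * (b 0 j - A * (2 * x 0 j))).
  have dx := is_derive_coord i j x.
  apply: is_derive_eq; rewrite /GRing.scale /= expr1; ring.
apply: is_derive_eq; rewrite (bigD1 i) //= eqxx mul1r big1 ?addr0 // => j ji.
by rewrite eq_sym (negbTE ji) mul0r.
Qed.

Lemma weak_partial1_quadratic Om b A i :
  weak_partial Om [:: i] (quadratic b A) (fun x => b 0 i - A * (2 * x 0 i)).
Proof.
move=> psi tpsi /=; rewrite mulN1r; apply: Rintegral_by_parts => //.
- exact: continuous_quadratic.
- exact: continuous_affine_coord.
- exact: is_derive_quadratic.
Qed.

(** Two integrations by parts, the first of them against the test function [partial j psi]. *)
Lemma weak_partial2_quadratic Om b A i j :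
  weak_partial Om [:: i; j] (quadratic b A) (fun=> - (A * 2) * (i == j)%:R).
Proof.
move=> psi tpsi; have tj := test_function_partial _ _ j tpsi.
have := weak_partial1_quadratic Om b A i _ tj; rewrite /= => ->.
rewrite mulN1r expr2 mulrNN mulr1 mul1r; apply/eqP; rewrite eqr_oppLR; apply/eqP.
apply: Rintegral_by_parts => //.
- exact: continuous_affine_coord.
- exact: cst_continuous.
- move=> x; have dx := is_derive_coord j i x.
  pose h := cst (b 0 i) - (A * 2) \*: (fun y : 'rV[R]_n => y 0 i).
  have -> : (fun y : 'rV[R]_n => b 0 i - A * (2 * y 0 i)) = h.
    by apply/funext => y; rewrite /h /= mulrA.
  by apply: is_derive_eq; rewrite sub0r /GRing.scale /= mulNr eq_sym.
Qed.

Lemma W2p_quadratic Om (p : R) b A : 0 <= p -> measurable Om -> bounded_set Om ->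
  W2p Om p (quadratic b A).
Proof.
move=> p0 mOm bOm; split; first exact/Lp_continuous/continuous_quadratic.
case=> [|i [|j [|]]] // _.
- exists (fun x => b 0 i - A * (2 * x 0 i)); last exact: weak_partial1_quadratic.
  by apply: Lp_continuous => //; exact: continuous_affine_coord.
- exists (fun=> - (A * 2) * (i == j)%:R); last exact: weak_partial2_quadratic.
  by apply: Lp_continuous => //; exact: cst_continuous.
Qed.

Lemma weak_hessian_quadratic Om (p : R) b A :
  0 <= p -> measurable Om -> bounded_set Om ->
  weak_hessian Om p (quadratic b A) (fun=> (- (A * 2))%:M).
Proof.
move=> p0 mOm bOm; split=> [x _|i j]; first by rewrite tr_scalar_mx.
have -> : (fun _ : 'rV[R]_n => (- (A * 2))%:M i j) =
    (fun=> - (A * 2) * (i == j)%:R).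
  by apply/funext => x; rewrite mxE [RHS]mulr_natr.
split; last exact: weak_partial2_quadratic.
by apply: Lp_continuous => //; exact: cst_continuous.
Qed.

End quadratic_test_functions.

(** * Uniformly elliptic operators on scalar matrices, the Euclidean norm *)

Section uniformly_elliptic_scalar.
Context {R : realType} {n : nat}.

Lemma char_poly_scalar (c : R) :
  char_poly (c%:M : 'M[R]_n.+1) = ('X - c%:P) ^+ n.+1.
Proof. by rewrite /char_poly /char_poly_mx map_scalar_mx -raddfB det_scalar. Qed.

Lemma eigenvalue_scalar (c e : R) : eigenvalue (c%:M : 'M[R]_n.+1) e = (e == c).
Proof. by rewrite eigenvalue_root_char char_poly_scalar rootE !hornerE expf_eq0 subr_eq0. Qed.

Lemma eigen_sum_scalar (P : R -> bool) (c : R) :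
  eigen_sum P (c%:M : 'M[R]_n.+1) = if P c then c *+ n.+1 else 0.
Proof.
rewrite /eigen_sum; under eq_set do rewrite eigenvalue_scalar.
case: ifP => Pc; last first.
  rewrite (_ : [set e | _] = set0) ?fsbig_set0 //.
  by apply/seteqP; split=> // e /= /andP[/eqP ->]; rewrite Pc.
rewrite (_ : [set e | _] = [set c]) ?fsbig_set1.
  by rewrite char_poly_scalar mup_XsubCX eqxx.
apply/seteqP; split=> e /=; first by move=> /andP[/eqP].
by move=> ->; rewrite eqxx.
Qed.

(** The lower Pucci bound against the zero matrix: for [a > 0] the only eigenvalue is [- a], with
    multiplicity [n.+1]. *)
Lemma uniformly_elliptic_scalar_ge (lam Lam a : R) (F : 'M[R]_n.+1 -> R) :
  uniformly_elliptic lam Lam F -> F 0 = 0 -> 0 <= a ->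
  - (Lam * (a *+ n.+1)) <= F (- a)%:M.
Proof.
move=> hF F0; rewrite le_eqVlt => /predU1P[<-|a0].
  by rewrite mul0rn mulr0 oppr0 raddf0 F0.
have /andP[+ _] := hF (- a)%:M 0 (tr_scalar_mx _ _) (trmx0 _ _ _).
rewrite F0 !subr0 /pucci_min !eigen_sum_scalar oppr_gt0 oppr_lt0 a0 (lt_gtF a0).
by rewrite mulr0 add0r mulNrn mulrN.
Qed.

End uniformly_elliptic_scalar.

(** * The Euclidean norm and its balls *)

Section euclidean_norm.
Context {R : realType} {n : nat}.
Implicit Types (x y c : 'rV[R]_n).

Lemma enorm_ge0 x : 0 <= enorm x.
Proof. exact: sqrtr_ge0. Qed.

Lemma sqr_enorm x : enorm x ^+ 2 = \sum_(i < n) x 0 i ^+ 2.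
Proof. by rewrite sqr_sqrtr // sumr_ge0 // => i _; exact: sqr_ge0. Qed.

Lemma enorm0 : enorm (0 : 'rV[R]_n) = 0.
Proof. by rewrite /enorm big1 ?sqrtr0 // => i _; rewrite mxE expr0n. Qed.

Lemma enormZ (k : R) x : enorm (k *: x) = `|k| * enorm x.
Proof.
rewrite /enorm -sqrtr_sqr -sqrtrM ?sqr_ge0 //; congr Num.sqrt.
by rewrite mulr_sumr; apply: eq_bigr => i _; rewrite mxE exprMn.
Qed.

Lemma enormN x : enorm (- x) = enorm x.
Proof. by rewrite -scaleN1r enormZ normrN1 mul1r. Qed.

Lemma enorm_distC x y : enorm (x - y) = enorm (y - x).
Proof. by rewrite -enormN opprB. Qed.

Lemma cauchy_schwarz x y : \sum_(i < n) x 0 i * y 0 i <= enorm x * enorm y.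
Proof.
have sx := sqr_enorm x; have sy := sqr_enorm y.
set s := \sum_i _; set a := enorm x; set b := enorm y.
(* This sum of squares equals [2ab(ab - s)], which settles the case [ab > 0]; otherwise one of the
   two vectors is zero. *)
have h : 0 <= \sum_(i < n) (b * x 0 i - a * y 0 i) ^+ 2.
  by apply: sumr_ge0 => i _; exact: sqr_ge0.
have E : \sum_(i < n) (b * x 0 i - a * y 0 i) ^+ 2 = 2 * (a * b) * (a * b - s).
  transitivity (b ^+ 2 * (\sum_(i < n) x 0 i ^+ 2) - 2 * a * b * s
                + a ^+ 2 * (\sum_(i < n) y 0 i ^+ 2)).
    rewrite /s !mulr_sumr -sumrB -big_split /=.
    by apply: eq_bigr => i _; ring.
  by rewrite -sx -sy -/a -/b; ring.
have [ab|ab] := ltP 0 (a * b).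
  by rewrite -subr_ge0 -(pmulr_rge0 _ (mulr_gt0 (ltr0n R 2) ab)) -E.
have ab0 : a * b = 0 by apply/eqP; rewrite eq_le ab mulr_ge0 // enorm_ge0.
rewrite ab0 /s big1 // => i _.
have zero (z : 'rV[R]_n) : enorm z = 0 -> z 0 i = 0.
  move=> z0; have := sqr_enorm z; rewrite z0 expr0n /= => /esym/eqP.
  rewrite psumr_eq0 => [/allP/(_ i)|j _]; last exact: sqr_ge0.
  by rewrite mem_index_enum /= sqrf_eq0 => /(_ isT)/eqP.
have /eqP := ab0; rewrite mulf_eq0 => /orP[] /eqP /zero ->.
  by rewrite mul0r.
by rewrite mulr0.
Qed.

Lemma ler_enormD x y : enorm (x + y) <= enorm x + enorm y.
Proof.
rewrite -(@ler_pXn2r _ 2) ?nnegrE ?addr_ge0 ?enorm_ge0 //.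
have -> : enorm (x + y) ^+ 2 =
    enorm x ^+ 2 + 2 * (\sum_(i < n) x 0 i * y 0 i) + enorm y ^+ 2.
  rewrite !sqr_enorm mulr_sumr -!big_split /=.
  by apply: eq_bigr => i _; rewrite mxE; ring.
have := cauchy_schwarz x y; nra.
Qed.

Lemma ler_enorm_dist y x z : enorm (x - z) <= enorm (x - y) + enorm (y - z).
Proof. by rewrite -[x - z](subrKA y) ler_enormD. Qed.

Lemma normr_coord_le_enorm x i : `|x 0 i| <= enorm x.
Proof.
rewrite -(@ler_pXn2r _ 2) ?nnegrE ?enorm_ge0 // sqr_enorm real_normK ?num_real //.
by rewrite (bigD1 i) //= lerDl sumr_ge0 // => j _; exact: sqr_ge0.
Qed.

Lemma eball_sub_box c (r : R) : eball c r `<=` box c r.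
Proof.
move=> x xr i; apply: le_lt_trans xr.
by have := normr_coord_le_enorm (x - c) i; rewrite !mxE.
Qed.

(** Completing the square: two paraboloids with different centers add up to a single [quadratic] and
    a constant, so a sum of this kind is a legitimate test function. *)
Lemma quadratic_centers c y (A1 A2 : R) x :
  quadratic (2 *: (A1 *: c + A2 *: y)) (A1 + A2) x =
  A1 * enorm c ^+ 2 + A2 * enorm y ^+ 2
  - (A1 * enorm (x - c) ^+ 2 + A2 * enorm (x - y) ^+ 2).
Proof.
rewrite !sqr_enorm !mulr_sumr -!big_split -sumrB /=.
by apply: eq_bigr => i _; rewrite !mxE; ring.
Qed.

Lemma continuous_sqr_enorm_dist c : continuous (fun x => enorm (x - c) ^+ 2).
Proof.
have -> : (fun x => enorm (x - c) ^+ 2) =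
    (fun x => enorm c ^+ 2 - quadratic (2 *: (1 *: c + 0 *: 0)) (1 + 0) x).
  by apply/funext => x; rewrite quadratic_centers; ring.
by apply: continuous_fctB; [exact: cst_continuous|exact: continuous_quadratic].
Qed.

Lemma continuous_enorm_dist c : continuous (fun x => enorm (x - c)).
Proof.
have -> : (fun x => enorm (x - c)) = (fun x => Num.sqrt (enorm (x - c) ^+ 2)).
  by apply/funext => x; rewrite sqrtr_sqr ger0_norm ?enorm_ge0.
move=> x; exact: (continuous_comp (@continuous_sqr_enorm_dist c x) (@sqrt_continuous _ _)).
Qed.

Lemma continuous_enorm : continuous (@enorm R n).
Proof.
have -> : @enorm R n = (fun x => enorm (x - 0)) by apply/funext => x; rewrite subr0.
exact: continuous_enorm_dist.
Qed.

Lemma nbhs_eball_center c (r : R) : 0 < r -> \forall x \near c, enorm (x - c) < r.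
Proof.
move=> r0; have cr : enorm (c - c) < r by rewrite subrr enorm0.
exact: cvgr_lt (@continuous_enorm_dist c c) _ cr.
Qed.

Lemma nbhs_eball x (P : set 'rV[R]_n) : nbhs x P -> exists2 r : R, 0 < r & eball x r `<=` P.
Proof.
move=> /nbhs_ballP[r /= r0 rP]; exists r => // y /eball_sub_box.
by rewrite box_ball //; exact: rP.
Qed.

End euclidean_norm.

(** With [N = n.+1] coordinates, [N] squares below [(r / N) ^ 2] sum to less than [r ^ 2 / N]. *)
Lemma box_sub_eball {R : realType} {n : nat} (c : 'rV[R]_n.+1) (r : R) :
  0 < r -> box c (r / n.+1%:R) `<=` eball c r.
Proof.
move=> r0 x xc; rewrite /eball /=.
rewrite -(@ltr_pXn2r _ 2) ?nnegrE ?enorm_ge0 ?ltW // sqr_enorm.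
apply: (@lt_le_trans _ _ (\sum_(i < n.+1) (r / n.+1%:R) ^+ 2)).
  apply: ltr_sum; first by apply/hasP; exists ord0; rewrite ?mem_index_enum.
  move=> i _; rewrite !mxE -real_normK ?num_real // ltr_pXn2r ?nnegrE //.
  exact: ltW (le_lt_trans (normr_ge0 _) (xc i)).
rewrite sumr_const card_ord -[leLHS]mulr_natl.
have -> : n.+1%:R * (r / n.+1%:R) ^+ 2 = r ^+ 2 / n.+1%:R.
  by field; rewrite nat1r pnatr_eq0.
by rewrite ler_pdivrMr ?ltr0n // ler_peMr ?sqr_ge0 // ler1n.
Qed.

(** * Touching from below and the barrier *)

(** The second-order Taylor remainder of a power, multiplied by [s0] to avoid the exponent [k - 1].
    The remainder [P_k] satisfies [P_(k+1) = s P_k + (k+1) s0^k (s - s0)^2]; with [s <= 4 s0] this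
    gives the recursion for the constant. *)
Lemma exprS_taylor_le {R : realType} (k : nat) :
  exists2 C : R, 0 <= C & forall s0 s : R, 0 <= s -> s <= 4 * s0 ->
    (s ^+ k.+1 - s0 ^+ k.+1 - k.+1%:R * s0 ^+ k * (s - s0)) * s0
      <= C * s0 ^+ k * (s - s0) ^+ 2.
Proof.
elim: k => [|k [C C0 IH]].
  by exists 0 => // s0 s _ _; rewrite !expr1 expr0 !mul0r mulr1 mul1r subrr mul0r.
exists (4 * C + k.+1%:R) => [|s0 s sge0 sle]; first by rewrite addr_ge0 // mulr_ge0.
have s00 : 0 <= s0 by lra.
have -> : (s ^+ k.+2 - s0 ^+ k.+2 - k.+2%:R * s0 ^+ k.+1 * (s - s0)) * s0 =
    s * ((s ^+ k.+1 - s0 ^+ k.+1 - k.+1%:R * s0 ^+ k * (s - s0)) * s0)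
    + k.+1%:R * s0 ^+ k.+1 * (s - s0) ^+ 2.
  by rewrite -[k.+2%:R]natr1 !(exprSr _ k.+1) !(exprSr _ k); ring.
rewrite [leRHS](_ : _ = 4 * C * s0 ^+ k.+1 * (s - s0) ^+ 2
    + k.+1%:R * s0 ^+ k.+1 * (s - s0) ^+ 2); last by ring.
rewrite lerD2r.
apply: (le_trans (ler_wpM2l sge0 (IH s0 s sge0 sle))).
have -> : 4 * C * s0 ^+ k.+1 * (s - s0) ^+ 2 =
    4 * s0 * (C * s0 ^+ k * (s - s0) ^+ 2) by rewrite exprS; ring.
apply: ler_wpM2r => //; apply: mulr_ge0; last exact: sqr_ge0.
by apply: mulr_ge0 => //; exact: exprn_ge0.
Qed.

(* If the barrier is touched at distance d <= 1 from its center, it lies locally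
   above a paraboloid with Hessian -2A, A = a d^(2n+2) (n+2 + 9C).  The last
   equation makes Lam * 2A * (n+1) at most half of (d/(n+1))^(n+1), which is the
   measure of a cube contained in the ball of radius d/2. *)
Definition barrier_coef {R : realType} (n : nat) (Lam a : R) : Prop :=
  0 < a /\ exists C : R, [/\ 0 <= C,
    forall s0 s : R, 0 <= s -> s <= 4 * s0 ->
      (s ^+ n.+2 - s0 ^+ n.+2 - n.+2%:R * s0 ^+ n.+1 * (s - s0)) * s0
        <= C * s0 ^+ n.+1 * (s - s0) ^+ 2 &
    a * (4 * Lam * (n.+2%:R + 9 * C) * n.+1%:R) = n.+1%:R^-1 ^+ n.+1].

Lemma barrier_coef_exists {R : realType} (n : nat) (Lam : R) :
  0 < Lam -> exists a, barrier_coef n Lam a.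
Proof.
move=> Lam0; have [C C0 hC] := @exprS_taylor_le R n.+1.
have q0 : 0 < 4 * Lam * (n.+2%:R + 9 * C) * n.+1%:R.
  by rewrite !mulr_gt0 // ltr_wpDr // mulr_ge0.
exists (n.+1%:R^-1 ^+ n.+1 / (4 * Lam * (n.+2%:R + 9 * C) * n.+1%:R)); split.
  by rewrite divr_gt0 // exprn_gt0 // invr_gt0.
by exists C; split=> //; rewrite divfK // gt_eqF.
Qed.

(** * Supersolutions touched from below by paraboloids and by the barrier *)

Section touching.
Context {R : realType} {n : nat}.
Variables (lam Lam p : R) (Om : set 'rV[R]_n.+1) (F : 'M[R]_n.+1 -> R).
Variable u : 'rV[R]_n.+1 -> R.
Hypotheses (p0 : 0 <= p) (oOm : open Om) (bOm : bounded_set Om).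
Hypotheses (F0 : F 0 = 0) (hF : uniformly_elliptic lam Lam F).
Hypothesis hu : visc_supersolution Om p F (superlevel_rhs Om u) (fun=> 0) u.

Definition superlevel v := [set y | Om y /\ v <= u y].

Definition superlevel_measure v : R := fine (lebesgue_rV n.+1 (superlevel v)).

Lemma continuous_solution x : Om x -> {for x, continuous u}.
Proof.
move=> Omx; have [cu _ _] := hu.
have := continuous_subspaceW (@subset_closure _ Om) cu.
by rewrite continuous_open_subspace // => /(_ x); apply; rewrite inE.
Qed.

Lemma open_solution_lt v : open [set y | Om y /\ u y < v].
Proof.
rewrite openE => y [Omy uy]; rewrite /interior.
apply: filterI; first exact: open_nbhs_nbhs.
exact: cvgr_lt (continuous_solution y Omy) _ uy.
Qed.

Lemma open_solution_gt v : open [set y | Om y /\ v < u y].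
Proof.
rewrite openE => y [Omy uy]; rewrite /interior.
apply: filterI; first exact: open_nbhs_nbhs.
exact: cvgr_gt (continuous_solution y Omy) _ uy.
Qed.

Lemma measurable_superlevel v : measurable (superlevel v).
Proof.
have -> : superlevel v = Om `\` [set y | Om y /\ u y < v].
  apply/seteqP; split=> y [Omy uy].
    by split=> // -[_]; rewrite ltNge uy.
  split=> //; rewrite leNgt; apply/negP => h; exact: uy.
by apply: measurableD; apply: measurable_open_rV => //; exact: open_solution_lt.
Qed.

Lemma le_superlevel_measure (A : set 'rV[R]_n.+1) v : measurable A ->
  A `<=` superlevel v -> fine (lebesgue_rV n.+1 A) <= superlevel_measure v.
Proof.
move=> mA AS; have mS := measurable_superlevel v.
have bS : bounded_set (superlevel v).
  have [M [Mr hM]] := bOm; exists M; split=> // M' /hM h x [Omx _].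
  exact: h.
have lS := lebesgue_rV_bounded_lty _ mS bS.
have AleS : (lebesgue_rV n.+1 A <= lebesgue_rV n.+1 (superlevel v))%E.
  by apply: le_measure; rewrite ?inE.
apply: fine_le => //; rewrite ge0_fin_numE ?measure_ge0 //.
exact: le_lt_trans lS.
Qed.

(** If [m] were larger, then by ellipticity [F (D^2 phi) - f] would exceed a positive constant on a
    whole ball around [x0], against the nonpositive essential lower limit. *)
Lemma touching_superlevel_measure x0 (b : 'rV[R]_n.+1) (A m : R) :
  Om x0 -> 0 <= A ->
  (\forall x \near x0, u x0 - quadratic b A x0 <= u x - quadratic b A x) ->
  (\forall x \near x0, m <= superlevel_measure (u x)) ->
  m <= Lam * ((A * 2) *+ n.+1).
Proof.
move=> Omx0 A0 touch /nbhs_eball[r r0 hm]; rewrite leNgt; apply/negP => mlt.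
have mOm : measurable Om by exact: measurable_open_rV.
have [_ _ h] := hu.
have := h (quadratic b A) _ x0 (W2p_quadratic _ _ _ _ p0 mOm bOm)
  (continuous_subspaceT (continuous_quadratic b A))
  (weak_hessian_quadratic _ _ b A p0 mOm bOm) Omx0 touch.
apply/negP; rewrite -ltNge.
apply: (@lt_le_trans _ _ (m - Lam * ((A * 2) *+ n.+1))%:E).
  by rewrite lte_fin subr_gt0.
apply: (@le_trans _ _ (ess_inf_on (Om `&` eball x0 r)
    (fun x => F (- (A * 2))%:M - superlevel_rhs Om u x))); last first.
  by apply: ereal_sup_ubound; exists r.
apply: ereal_sup_ubound => /=; apply: aeW => x [_ /hm mx].
rewrite lee_fin addrC opprK lerD //.
by apply: (uniformly_elliptic_scalar_ge lam) => //; rewrite mulr_ge0.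
Qed.

Lemma superlevel_measure_gt0 z v : Om z -> v < u z -> 0 < superlevel_measure v.
Proof.
move=> Omz vz; have : nbhs z [set y | Om y /\ v < u y].
  by apply: open_nbhs_nbhs; split => //; exact: open_solution_gt.
move=> /nbhs_ballP[r /= r0 rS].
apply: (@lt_le_trans _ _ (fine (lebesgue_rV n.+1 (box z r)))).
  by rewrite [lebesgue_rV _ _]lebesgue_rV_box //= exprn_gt0 // mulr_gt0.
apply: le_superlevel_measure; first exact: measurable_box.
by rewrite box_ball // => y /rS[? /ltW].
Qed.

(** Superlevel sets shrink as the level rises, and [u] stays below [v] near [x0] by continuity. *)
Lemma near_superlevel_measure x0 v : Om x0 -> u x0 < v ->
  \forall x \near x0, superlevel_measure v <= superlevel_measure (u x).
Proof.
move=> Omx0 uv.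
have nv : \forall x \near x0, u x < v.
  exact: cvgr_lt (continuous_solution x0 Omx0) _ uv.
apply: filterS nv => x xv; apply: le_superlevel_measure; first exact: measurable_superlevel.
by move=> y [Omy vy]; split=> //; exact: (le_trans (ltW xv)).
Qed.

Lemma not_local_min x0 : Om x0 -> ~ (\forall x \near x0, u x0 <= u x).
Proof.
move=> Omx0 hmin.
have touch : \forall x \near x0, u x0 - quadratic 0 0 x0 <= u x - quadratic 0 0 x.
  apply: filterS hmin => x ux; rewrite /quadratic !big1 ?subr0 //.
    by move=> i _; rewrite mxE !mul0r subr0.
  by move=> i _; rewrite mxE !mul0r subr0.
have [m m0 hm] : exists2 m, 0 < m & \forall x \near x0, m <= superlevel_measure (u x).
  (* If [u] is larger somewhere, a level [v] strictly between the two values supplies [m]. *)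
  have [[z [Omz uz]]|nz] := pselect (exists z, Om z /\ u x0 < u z).
    have [v /andP[v1 v2]] : exists v, u x0 < v < u z.
      by exists ((u x0 + u z) / 2); rewrite !midf_lt.
    exists (superlevel_measure v); first exact: superlevel_measure_gt0 v2.
    exact: near_superlevel_measure v1.
  (* Otherwise [u x0] is the maximum over [Om], and the superlevel set at this level contains a
     neighborhood of the local minimum point [x0]. *)
  exists (superlevel_measure (u x0)).
    have /nbhs_ballP[r /= r0 rS] : nbhs x0 (Om `&` [set x | u x0 <= u x]).
      by apply: filterI => //; exact: open_nbhs_nbhs.
    apply: (@lt_le_trans _ _ (fine (lebesgue_rV n.+1 (box x0 r)))).
      by rewrite [lebesgue_rV _ _]lebesgue_rV_box //= exprn_gt0 // mulr_gt0.
    apply: le_superlevel_measure; first exact: measurable_box.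
    by rewrite box_ball // => y /rS[].
  have nOm : \forall x \near x0, Om x by exact: open_nbhs_nbhs.
  apply: filterS nOm => x Omx; apply: le_superlevel_measure; first exact: measurable_superlevel.
  move=> y [Omy uy]; split=> //; apply: le_trans uy.
  by rewrite leNgt; apply/negP => h; apply: nz; exists x.
have := touching_superlevel_measure x0 0 0 m Omx0 (lexx 0) touch hm.
by rewrite mul0r mul0rn mulr0 leNgt m0.
Qed.

Lemma touching_paraboloids x0 (c y : 'rV[R]_n.+1) (A1 A2 m : R) :
  Om x0 -> 0 <= A1 -> 0 <= A2 ->
  (\forall x \near x0,
    u x0 + A1 * enorm (x0 - c) ^+ 2 + A2 * enorm (x0 - y) ^+ 2
    <= u x + A1 * enorm (x - c) ^+ 2 + A2 * enorm (x - y) ^+ 2) ->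
  (\forall x \near x0, m <= superlevel_measure (u x)) ->
  m <= Lam * (((A1 + A2) * 2) *+ n.+1).
Proof.
move=> Omx0 A10 A20 h hm.
apply: (touching_superlevel_measure x0 (2 *: (A1 *: c + A2 *: y))) hm => //.
  exact: addr_ge0.
by apply: filterS h => x hx; rewrite !quadratic_centers; lra.
Qed.

(** A negative minimum over the compact closure can be attained neither on the boundary, by the
    boundary condition, nor inside, by [not_local_min]. *)
Lemma solution_ge0 x : Om x -> 0 <= u x.
Proof.
move=> Omx; rewrite leNgt; apply/negP => ux.
have [cu u0 _] := hu.
have cO : compact (closure Om).
  have [M M0 hM] := ex_strict_bound_gt0 bOm.
  apply: (subclosed_compact _ (compact_norm_le M)); first exact: closed_closure.
  have cM : closed [set x : 'rV[R]_n.+1 | `|x| <= M].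
    by apply: closed_sublevel => z; exact: norm_continuous.
  rewrite closureE => z; apply; split=> // w /hM.
  exact: ltW.
have ne : closure Om !=set0 by exists x; exact: subset_closure.
have [c cl cmin] := compact_EVT_min ne cO cu.
have cx : u c < 0.
  by apply: le_lt_trans ux; apply: cmin; rewrite inE; exact: subset_closure.
have [Omc|nOmc] := pselect (Om c).
  apply: (not_local_min _ Omc).
  have nOm : \forall x \near c, Om x by exact: open_nbhs_nbhs.
  by apply: filterS nOm => z Omz; apply: cmin; rewrite inE; exact: subset_closure.
have : boundary Om c.
  by split; [rewrite inE in cl|move/interior_subset].
by move=> /u0; rewrite leNgt cx.
Qed.

(** The barrier is flatter than quadratic at its center, so touching there allows paraboloids of
    arbitrarily small opening, while the superlevel measure stays above a fixed [m > 0]. *)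
Lemma touching_center c (a : R) (k : nat) : Om c -> 0 < Lam -> 0 < a -> (0 < k)%N ->
  (exists2 z, Om z & u c < u z) ->
  ~ (\forall x \near c, u c <= u x + a * (enorm (x - c) ^+ 2) ^+ k.+1).
Proof.
move=> Omc Lam0 a0 k0 [z Omz cz] near_c.
have [v /andP[v1 v2]] : exists v, u c < v < u z.
  by exists ((u c + u z) / 2); rewrite !midf_lt.
set m := superlevel_measure v; have m0 : 0 < m by exact: superlevel_measure_gt0 v2.
have hm := near_superlevel_measure c v Omc v1.
have N0 : 0 < n.+1%:R :> R by rewrite ltr0n.
(* This opening turns the bound of [touching_paraboloids] into [m / 2]. *)
pose A := m / (4 * Lam * n.+1%:R).
have A0 : 0 < A by rewrite divr_gt0 // !mulr_gt0.
have hle : \forall x \near c, u c + A * enorm (c - c) ^+ 2 + 0 * enorm (c - c) ^+ 2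
    <= u x + A * enorm (x - c) ^+ 2 + 0 * enorm (x - c) ^+ 2.
  (* Since [2k >= 1], the bounds by 1 and [A / a] give [a |x - c|^(2k) <= a |x - c| <= A]. *)
  have small : \forall x \near c, enorm (x - c) < Num.min 1 (A / a).
    have d0 : 0 < Num.min 1 (A / a) by rewrite lt_min ltr01 divr_gt0.
    exact: nbhs_eball_center.
  apply: filterS2 near_c small => x xc xs.
  rewrite subrr enorm0 expr0n mulr0 !mul0r !addr0; apply: (le_trans xc).
  rewrite lerD2l exprS mulrCA mulrC; apply: ler_wpM2r; first exact: sqr_ge0.
  move: xs; rewrite lt_min => /andP[x1 xA].
  rewrite mulrC -ler_pdivlMr //; apply: le_trans (ltW xA).
  rewrite -exprM -[leRHS]expr1; apply: ler_wiXn2l; rewrite ?enorm_ge0 ?ltW //.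
  by rewrite muln_gt0.
have := touching_paraboloids c c c A 0 m Omc (ltW A0) (lexx 0) hle hm.
rewrite addr0 -mulr_natr.
have -> : Lam * (A * 2 * n.+1%:R) = m / 2 by rewrite /A; field; rewrite !gt_eqF.
by rewrite leNgt gtr_pMr ?m0 // invf_lt1 // ltr1n.
Qed.

Lemma touching_off_center c x0 (a r : R) : 0 < Lam -> barrier_coef n Lam a ->
  0 < enorm (x0 - c) -> enorm (x0 - c) < r -> r <= 1 ->
  (forall x, enorm (x - c) <= r -> Om x) ->
  ~ (forall x, enorm (x - c) <= r ->
       u x0 + a * (enorm (x0 - c) ^+ 2) ^+ n.+2
       <= u x + a * (enorm (x - c) ^+ 2) ^+ n.+2).
Proof.
move=> Lam0 [a0 [C [C0 taylor aE]]]; set d := enorm (x0 - c) => d0 dr r1 rOm hmin.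
have Omx0 : Om x0 by apply: rOm; exact: ltW.
set s0 := d ^+ 2; have s00 : 0 < s0 by rewrite exprn_gt0.
(* In the variable [s = |x - c|^2], the linear Taylor term at [s0] is the paraboloid of opening [A1]
   centered at [c]; the remainder is absorbed by the one of opening [A2] centered at [x0]. *)
pose A1 := a * (n.+2%:R * s0 ^+ n.+1); pose A2 := a * (9 * C * s0 ^+ n.+1).
have A10 : 0 <= A1 by rewrite ltW // !mulr_gt0 ?exprn_gt0.
have A20 : 0 <= A2 by rewrite !mulr_ge0 ?exprn_ge0 // ltW.
have near_x0 : \forall x \near x0, u x0 + A1 * enorm (x0 - c) ^+ 2 + A2 * enorm (x0 - x0) ^+ 2
    <= u x + A1 * enorm (x - c) ^+ 2 + A2 * enorm (x - x0) ^+ 2.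
  (* Distance below [d] gives [|x - c| <= 2d], that is [s <= 4 s0]; distance below [r - d] keeps [x]
     in the ball. *)
  have small : \forall x \near x0, enorm (x - x0) < Num.min d (r - d).
    by apply: nbhs_eball_center; rewrite lt_min d0 subr_gt0.
  apply: filterS small => x; rewrite lt_min => /andP[hd hr].
  have t1 := ler_enorm_dist x0 x c; have t2 := ler_enorm_dist x x0 c.
  rewrite (enorm_distC x0 x) -/d in t1 t2.
  have e0 := enorm_ge0 (x - c); have h0 := enorm_ge0 (x - x0).
  rewrite subrr enorm0 -/d -/s0.
  have xr : enorm (x - c) <= r by lra.
  have := hmin x xr; rewrite -/s0; move: t1 t2 e0 h0 hd hr {xr}.
  move: (enorm (x - c)) (enorm (x - x0)) => e h t1 t2 e0 h0 hd hr.
  have se : e ^+ 2 <= 4 * s0.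
    have -> : 4 * s0 = (2 * d) ^+ 2 by rewrite /s0; ring.
    by rewrite ler_pXn2r ?nnegrE //; lra.
  have := taylor s0 (e ^+ 2) (sqr_ge0 e) se.
  (* Factor the difference of squares: [e + d <= 3d] and [|e - d| <= h] by the triangle
     inequality. *)
  have sq : (e ^+ 2 - s0) ^+ 2 <= 9 * s0 * h ^+ 2.
    have -> : (e ^+ 2 - s0) ^+ 2 = (e + d) ^+ 2 * (e - d) ^+ 2 by rewrite /s0; ring.
    have -> : 9 * s0 = (3 * d) ^+ 2 by rewrite /s0; ring.
    apply: ler_pM; rewrite ?sqr_ge0 //.
      by rewrite ler_pXn2r ?nnegrE //; lra.
    rewrite -[leLHS]real_normK ?num_real // ler_pXn2r ?nnegrE // ler_norml.
    by apply/andP; split; lra.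
  set P := e ^+ 2 ^+ n.+2 - _ - _ => hP hu0.
  have P_le : P <= 9 * C * s0 ^+ n.+1 * h ^+ 2.
    rewrite -(ler_pM2r s00); apply: (le_trans hP).
    have -> : 9 * C * s0 ^+ n.+1 * h ^+ 2 * s0 = C * s0 ^+ n.+1 * (9 * s0 * h ^+ 2) by ring.
    by apply: ler_wpM2l => //; rewrite mulr_ge0 // exprn_ge0 // ltW.
  have aP := ler_wpM2l (ltW a0) P_le.
  have E1 : A1 * e ^+ 2 - A1 * s0 + a * P = a * (e ^+ 2) ^+ n.+2 - a * s0 ^+ n.+2.
    by rewrite /A1 /P; ring.
  have E2 : A2 * h ^+ 2 = a * (9 * C * s0 ^+ n.+1 * h ^+ 2) by rewrite /A2; ring.
  rewrite expr0n /= mulr0 addr0 E2; lra.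
(* The lower bound that the touching inequality gives for [u] on the ball of radius [d / 2] around
   [c]. *)
pose v := u x0 + a * (s0 ^+ n.+2 - (s0 / 4) ^+ n.+2).
have uv : u x0 < v.
  rewrite ltrDl mulr_gt0 // subr_gt0 ltr_pXn2r ?nnegrE ?ltW //.
    by rewrite ltr_pdivrMr // ltr_pMr // ltr1n.
  by rewrite divr_gt0.
have N0 : 0 < n.+1%:R :> R by rewrite ltr0n.
have := touching_paraboloids x0 c x0 A1 A2 _ Omx0 A10 A20 near_x0
  (near_superlevel_measure x0 v Omx0 uv).
apply/negP; rewrite -ltNge.
have dN0 : 0 < d / 2 / n.+1%:R by rewrite !divr_gt0.
(* The cube of side [d / n.+1] lies in that ball. As [d <= 1], [s0 ^+ n.+1 <= d ^+ n.+1], so by the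
   choice of [a] the paraboloid bound is at most half of its volume. *)
apply: (@lt_le_trans _ _ (fine (lebesgue_rV n.+1 (box c (d / 2 / n.+1%:R))))).
  rewrite [lebesgue_rV _ _]lebesgue_rV_box //= -mulr_natr.
  have -> : 2 * (d / 2 / n.+1%:R) = d * n.+1%:R^-1 by field; rewrite gt_eqF.
  have -> : Lam * ((A1 + A2) * 2 * n.+1%:R) =
      s0 ^+ n.+1 * (a * (4 * Lam * (n.+2%:R + 9 * C) * n.+1%:R)) / 2.
    by rewrite /A1 /A2; field.
  rewrite aE [ltRHS]exprMn.
  have c0 : 0 < (n.+1%:R^-1 : R) ^+ n.+1 by rewrite exprn_gt0 // invr_gt0.
  have dn0 : 0 < d ^+ n.+1 by rewrite exprn_gt0.
  have sd : s0 ^+ n.+1 <= d ^+ n.+1.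
    rewrite /s0 -exprM; apply: ler_wiXn2l; rewrite ?ltW //.
      exact: lt_le_trans r1.
    by rewrite leq_pmull.
  move: c0 dn0 sd; move: (_ ^+ n.+1) (d ^+ n.+1) (s0 ^+ n.+1) => X Y Z X0 Y0 ZY.
  have := ler_wpM2r (ltW X0) ZY; have := mulr_gt0 Y0 X0; lra.
apply: le_superlevel_measure; first exact: measurable_box.
move=> y /box_sub_eball; rewrite /eball /= => /(_ (divr_gt0 d0 (ltr0n _ 2))) yc.
have yr : enorm (y - c) <= r by lra.
split; first exact: rOm.
have := hmin y yr; rewrite -/s0.
have : (enorm (y - c) ^+ 2) ^+ n.+2 <= (s0 / 4) ^+ n.+2.
  rewrite ler_pXn2r ?nnegrE ?sqr_ge0 //; last by rewrite divr_ge0 // ltW.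
  have -> : s0 / 4 = (d / 2) ^+ 2 by rewrite /s0; field.
  by rewrite ler_pXn2r ?nnegrE ?enorm_ge0 ?ltW // divr_gt0.
move=> /(ler_wpM2l (ltW a0)); rewrite /v; lra.
Qed.

Lemma barrier_le c (a r : R) x : 0 < Lam -> barrier_coef n Lam a ->
  0 < r -> r <= 1 -> (forall x, enorm (x - c) <= r -> Om x) ->
  (exists2 z, Om z & u c < u z) -> enorm (x - c) <= r ->
  a * ((r ^+ 2) ^+ n.+2 - (enorm (x - c) ^+ 2) ^+ n.+2) <= u x.
Proof.
move=> Lam0 ha r0 r1 rOm hz xr; have [a0 _] := ha.
have Omc : Om c by apply: rOm; rewrite subrr enorm0 ltW.
pose w x := u x + a * (enorm (x - c) ^+ 2) ^+ n.+2.
pose B := [set x : 'rV[R]_n.+1 | enorm (x - c) <= r].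
have cB : compact B.
  have [M M0 hM] := ex_strict_bound_gt0 bOm.
  apply: (subclosed_compact _ (compact_norm_le M)).
    by apply: closed_sublevel => z; exact: continuous_enorm_dist.
  by move=> z /rOm /hM; exact: ltW.
have cw : {within B, continuous w}.
  apply: continuous_in_subspaceT => z; rewrite inE => /rOm Omz.
  have cs : continuous (fun x : 'rV[R]_n.+1 => a * (enorm (x - c) ^+ 2) ^+ n.+2).
    apply: continuous_fctM; first exact: cst_continuous.
    by apply: continuous_fctX; exact: continuous_sqr_enorm_dist.
  exact: (cvgD (continuous_solution z Omz) (cs z)).
have Bn0 : B !=set0 by exists c; rewrite /B /= subrr enorm0 ltW.
have [x0 Bx0 x0min] := compact_EVT_min Bn0 cB cw.
rewrite inE /B /= in Bx0.
have {}x0min z : enorm (z - c) <= r -> w x0 <= w z.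
  by move=> zr; apply: x0min; rewrite inE.
rewrite leNgt; apply/negP => ux.
have wx0 : w x0 < a * (r ^+ 2) ^+ n.+2.
  by apply: (le_lt_trans (x0min x xr)); rewrite /w; lra.
(* The barrier vanishes on the sphere and [u >= 0], so a negative minimum of the difference is
   attained strictly inside the ball. *)
have x0r : enorm (x0 - c) < r.
  have : a * (enorm (x0 - c) ^+ 2) ^+ n.+2 < a * (r ^+ 2) ^+ n.+2.
    by apply: le_lt_trans wx0; rewrite /w lerDr solution_ge0 //; exact: rOm.
  by rewrite ltr_pM2l // !ltr_pXn2r ?nnegrE ?sqr_ge0 ?enorm_ge0 ?ltW.
have [x0c|x0c] := eqVneq (enorm (x0 - c)) 0.
  have {}x0c : x0 = c.
    apply/rowP => i; apply/eqP; rewrite -subr_eq0.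
    have := normr_coord_le_enorm (x0 - c) i; rewrite x0c normr_le0.
    by rewrite !mxE.
  apply: (touching_center c a n.+1 Omc Lam0 a0 _ hz) => //.
  apply: filterS (nbhs_eball_center c r r0) => z /ltW /x0min.
  by rewrite /w x0c subrr enorm0 !expr0n /= mulr0 addr0.
apply: (touching_off_center c x0 a r Lam0 ha _ x0r r1 rOm) => //.
by rewrite lt_neqAle eq_sym x0c enorm_ge0.
Qed.

(** The center may be a maximum point, and the closed ball may leave [Om]. Both are avoided by
    moving the center by less than [t] and shrinking the radius to [e - t]; then [t] tends to 0. *)
Lemma inner_ball_barrier_le c (a e : R) x : 0 < Lam -> barrier_coef n Lam a ->
  0 < e -> e <= 1 -> eball c e `<=` Om -> eball c e x ->
  a * ((e ^+ 2) ^+ n.+2 - (enorm (x - c) ^+ 2) ^+ n.+2) <= u x.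
Proof.
move=> Lam0 ha e0 e1 eOm xe; have [a0 _] := ha.
have Omc : Om c by apply: eOm; rewrite /eball /= subrr enorm0.
set d := enorm (x - c).
(* A lower bound for all the shifted barriers at [x], because [|x - c1| <= d + t]. *)
pose h (t : R) := a * (((e - t) ^+ 2) ^+ n.+2 - ((d + t) ^+ 2) ^+ n.+2).
have hle t : 0 < t -> t < e -> h t <= u x.
  move=> t0 te.
  have [c1 c1c uc1] : exists2 c1, enorm (c1 - c) < t & u c1 < u c.
    apply: contrapT => nex; apply: (not_local_min c Omc).
    apply: filterS (nbhs_eball_center c t t0) => z zt.
    by rewrite leNgt; apply/negP => zc; apply: nex; exists z.
  have tri := ler_enorm_dist c x c1; rewrite (enorm_distC c c1) -/d in tri.
  have et0 : 0 < e - t by lra.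
  have d0 : 0 <= d := enorm_ge0 _.
  have [xr|xr] := leP (enorm (x - c1)) (e - t).
    apply: (@le_trans _ _ (a * (((e - t) ^+ 2) ^+ n.+2 - (enorm (x - c1) ^+ 2) ^+ n.+2))).
      rewrite ler_pM2l // lerD2l lerN2 !ler_pXn2r ?nnegrE ?sqr_ge0 ?enorm_ge0 //; lra.
    apply: barrier_le => //; first lra.
      move=> z zr; apply: eOm; rewrite /eball /=.
      have := ler_enorm_dist c1 z c; lra.
    by exists c.
  (* Outside the smaller ball [d + t > e - t], so [h t] is nonpositive. *)
  apply: (@le_trans _ _ 0); last exact/solution_ge0/eOm.
  rewrite /h pmulr_rle0 // subr_le0 !ler_pXn2r ?nnegrE ?sqr_ge0 //; lra.
have ch : continuous h.
  apply: continuous_fctM; first exact: cst_continuous.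
  have ci : continuous (fun t : R => t) by move=> t; exact: cvg_id.
  apply: continuous_fctB; do 2!apply: continuous_fctX.
    by apply: continuous_fctB; [exact: cst_continuous|exact: ci].
  by apply: continuous_fctD; [exact: cst_continuous|exact: ci].
have h0 : h 0 = a * ((e ^+ 2) ^+ n.+2 - (d ^+ 2) ^+ n.+2) by rewrite /h subr0 addr0.
rewrite -h0 leNgt; apply/negP => uh.
have /nbhs_ballP[q /= q0 hq] : \forall t \near (0 : R), u x < h t.
  exact: cvgr_gt (ch 0) _ uh.
pose t := Num.min q e / 2.
have m0 : 0 < Num.min q e by rewrite lt_min q0 e0.
have tm : t < Num.min q e by rewrite /t; lra.
have t0 : 0 < t by rewrite /t; lra.
move: (tm); rewrite lt_min => /andP[tq te].
have : ball 0 q t by rewrite /ball /= sub0r normrN gtr0_norm.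
by move=> /hq; rewrite ltNge hle.
Qed.

End touching.

(** * The gradient near the boundary *)

Section gradient.
Context {R : realType} {n : nat}.
Implicit Types (u : 'rV[R]_n.+1 -> R) (x v c y : 'rV[R]_n.+1).

Lemma derive_grad u x v : differentiable u x ->
  'D_v u x = \sum_(i < n.+1) grad u x 0 i * v 0 i.
Proof.
move=> du; rewrite deriveE // {1}(row_sum_delta v) linear_sum.
apply: eq_bigr => i _; rewrite linearZ /= mxE /partial deriveE // mulrC.
by [].
Qed.

Lemma boundary_eball c y (e : R) : 0 < e -> boundary (eball c e) y -> enorm (y - c) = e.
Proof.
move=> e0 [cl nint]; apply/eqP; rewrite eq_le; apply/andP; split.
  have cB : closed [set x : 'rV[R]_n.+1 | enorm (x - c) <= e].
    by apply: closed_sublevel; exact: continuous_enorm_dist.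
  have sub : eball c e `<=` [set x | enorm (x - c) <= e] by move=> x; exact: ltW.
  by move: cl => /(closure_subset sub); rewrite -((closure_id _).1 cB).
rewrite leNgt; apply/negP => ye; apply: nint.
exact: cvgr_lt (continuous_enorm_dist c y) _ ye.
Qed.

(** The mean value theorem on a short segment from [y] towards [c]: [u] rises from at most 0 to at
    least [k t1] over the length [t1]. Cauchy-Schwarz with the unit direction passes to the
    gradient. *)
Lemma grad_ge_near_boundary (Om : set 'rV[R]_n.+1) u c y (e k d : R) :
  {within closure Om, continuous u} -> (forall x, Om x -> differentiable u x) ->
  0 < e -> enorm (y - c) = e -> eball c e `<=` Om -> closure Om y -> u y <= 0 ->
  (forall x, eball c e x -> k * (e - enorm (x - c)) <= u x) -> 0 < d ->
  exists2 x, Om x & enorm (x - y) < d /\ k <= enorm (grad u x).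
Proof.
move=> cu du e0 yc eOm cly uy hk d0.
pose t1 := Num.min d e / 2.
have m0 : 0 < Num.min d e by rewrite lt_min d0 e0.
have t10 : 0 < t1 by rewrite /t1; lra.
have : t1 < Num.min d e by rewrite /t1; lra.
rewrite lt_min => /andP[t1d t1e].
pose v : 'rV[R]_n.+1 := e^-1 *: (c - y).
have v1 : enorm v = 1.
  by rewrite enormZ enorm_distC yc gtr0_norm ?invr_gt0 // mulVf // gt_eqF.
pose T (t : R) := t *: v + y.
have Tc t : 0 <= t -> t <= e -> enorm (T t - c) = e - t.
  move=> tge tle; have -> : T t - c = (1 - t / e) *: (y - c).
    by rewrite /T /v scalerA; apply/rowP => i; rewrite !mxE; ring.
  rewrite enormZ yc ger0_norm; first by field; rewrite gt_eqF.
  by rewrite subr_ge0 ler_pdivrMr // mul1r.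
have Ty t : 0 <= t -> enorm (T t - y) = t.
  by move=> tge; rewrite /T addrK enormZ v1 mulr1 ger0_norm.
have TB t : 0 < t -> t <= e -> eball c e (T t).
  by move=> t0 te; rewrite /eball /= (Tc t (ltW t0) te); lra.
have dg (t : R) : t \in `]0, t1[ -> is_derive t 1 (u \o T) ('D_v u (T t)).
  rewrite in_itv /= => /andP[t0 tt1].
  apply: (is_derive_affine_comp _ _ _ _ v); first by move=> h; rewrite /T scaler1 scalerDl addrA.
  apply/derivableP/diff_derivable/du/eOm/TB => //; lra.
have cT : continuous T.
  move=> t; apply: cvgD; last exact: cvg_cst.
  by apply: cvgZr_tmp; exact: cvg_id.
(* The starting point [T 0 = y] is only known to lie in the closure, so continuity of [u] is used
   relative to [closure Om]. *)
have cg : {within `[0, t1], continuous (u \o T)}.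
  apply/subspace_continuousP => t /=; rewrite in_itv /= => /andP[t0 tt1].
  have clT s : 0 <= s -> s <= t1 -> closure Om (T s).
    rewrite le_eqVlt => /predU1P[<-|s0] st1; first by rewrite /T scale0r add0r.
    by apply: subset_closure; apply: eOm; apply: TB => //; lra.
  have := (subspace_continuousP _ _).1 cu (T t) (clT _ t0 tt1).
  apply: cvg_comp => A; rewrite /within /= => hA.
  have hA' : nbhs t (T @^-1` [set x | closure Om x -> A x]) := cT t _ hA.
  apply: filterS hA' => s /= hs.
  by rewrite in_itv /= => /andP[s0 st1]; apply: hs; exact: clT.
have [s s01] := MVT t10 dg cg.
rewrite subr0 /= => E; move: s01; rewrite in_itv /= => /andP[s0 st1].
have Bs : eball c e (T s) by apply: TB => //; lra.
exists (T s); first exact: eOm.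
split; first by rewrite (Ty s (ltW s0)); lra.
have B1 := hk _ (TB _ t10 (ltW t1e)).
rewrite (Tc t1 (ltW t10) (ltW t1e)) in B1.
have T0 : T 0 = y by rewrite /T scale0r add0r.
have kD : k <= 'D_v u (T s).
  by rewrite -(ler_pM2r t10) -E T0; lra.
apply: (le_trans kD); rewrite derive_grad; last exact/du/eOm.
by apply: (le_trans (cauchy_schwarz _ _)); rewrite v1 mulr1.
Qed.

End gradient.

(** * Lower bound for the gradient near the boundary *)

Theorem theorem3p4 (R : realType) (n : nat) (lam Lam p alpha : R)
    (Om : set 'rV[R]_n.+1) (F : 'M[R]_n.+1 -> R)
    (hlam : 0 < lam) (hlamLam : lam <= Lam)
    (hp : n.+1%:R < p)
    (halpha : 0 < alpha < 1)
    (hopen : open Om) (hbounded : bounded_set Om) (hconnected : connected Om)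
    (hboundary : C11_boundary Om)
    (hconvex : convex_sym F) (hF0 : F 0 = 0)
    (hF : uniformly_elliptic lam Lam F)
    (hball : uniform_inner_ball Om) :
  exists c0 : R -> R, (forall t, 0 < c0 t) /\
    forall u : 'rV[R]_n.+1 -> R,
      nonlocal_solution Om p F u -> C1alpha Om alpha u ->
      exists2 U : set 'rV[R]_n.+1, set_nbhs (boundary Om) U &
        forall x, U x -> Om x ->
          c0 (fine (C1alpha_norm Om alpha u)) < enorm (grad u x).
Proof.
have Lam0 : 0 < Lam := lt_le_trans hlam hlamLam.
have p0 : 0 <= p by rewrite ltW // (le_lt_trans _ hp).
have [a ha] := @barrier_coef_exists R n Lam Lam0; have [a0 _] := ha.
have [e0 e00 hball0] := hball.
(* The barrier estimate asks for balls of radius at most 1. *)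
pose e := Num.min e0 1.
have e_gt0 : 0 < e by rewrite lt_min e00 ltr01.
have [ee0 e1] : e <= e0 /\ e <= 1 by split; rewrite /e ge_min lexx ?orbT.
(* The slope of the barrier: for [0 <= d <= e], [e^(2n+4) - d^(2n+4) >= e^(2n+3) (e - d)]. *)
pose k := a * (e * (e ^+ 2) ^+ n.+1).
have k0 : 0 < k by rewrite !mulr_gt0 ?exprn_gt0.
(* The slope is fixed by [n], [Lam] and [e0]; half of it leaves room for the strict inequality
   around each boundary point. *)
exists (fun=> k / 2); split=> [t|u [usub usup] [cu du [G cG GE] _]].
  by rewrite divr_gt0.
exists [set x | Om x -> k / 2 < enorm (grad u x)]; last by move=> x; apply.
move=> y bdy; have [c' [e' [e0e' eOm' bdy']]] := hball0 y bdy.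
have e'0 : 0 < e' by exact: lt_trans e0e'.
have yc' := boundary_eball _ _ _ e'0 bdy'.
have cly : closure Om y by case: bdy.
(* The ball of radius [e] inside the given one, tangent to it at [y]. *)
pose c := y + (e / e') *: (c' - y).
have yc : enorm (y - c) = e.
  rewrite /c opprD addNKr enormN enormZ enorm_distC yc' gtr0_norm ?divr_gt0 //.
  by rewrite divfK // gt_eqF.
have eOm : eball c e `<=` Om.
  move=> x xe; apply: eOm'; rewrite /eball /= in xe *.
  have := ler_enorm_dist c x c'.
  have -> : c - c' = (1 - e / e') *: (y - c').
    by apply/rowP => i; rewrite !mxE; ring.
  rewrite enormZ yc' ger0_norm; last first.
    by rewrite subr_ge0 ler_pdivrMr // mul1r; lra.
  have -> : (1 - e / e') * e' = e' - e by field; rewrite gt_eqF.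
  lra.
have hk x : eball c e x -> k * (e - enorm (x - c)) <= u x.
  move=> xe; have := inner_ball_barrier_le lam Lam p Om F u p0 hopen hbounded hF0 hF usup
    c a e x Lam0 ha e_gt0 e1 eOm xe.
  apply: le_trans; rewrite /k -mulrA ler_pM2l //.
  have d0 := enorm_ge0 (x - c); rewrite /eball /= in xe.
  move: d0 xe; move: (enorm (x - c)) => d d0 de.
  have h : (d ^+ 2) ^+ n.+1 <= (e ^+ 2) ^+ n.+1.
    by rewrite ler_pXn2r ?nnegrE ?sqr_ge0 // ler_pXn2r ?nnegrE ?(ltW de) ?(ltW e_gt0).
  rewrite !(exprS _ n.+1).
  move: h; move: ((d ^+ 2) ^+ n.+1) ((e ^+ 2) ^+ n.+1) (exprn_ge0 n.+1 (sqr_ge0 d)) => X Y X0 XY.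
  have ed0 : 0 <= e - d by lra.
  have YX0 : 0 <= Y - X by lra.
  have Y0 : 0 <= Y by lra.
  have := mulr_ge0 (mulr_ge0 d0 ed0) Y0; have := mulr_ge0 (sqr_ge0 d) YX0; lra.
have uy : u y <= 0 by case: usub => _ + _; exact.
have cle : {within closure Om, continuous (fun x => enorm (G x))}.
  apply/subspace_continuousP => x clx.
  have cGx := (subspace_continuousP _ _).1 cG x clx.
  exact: (cvg_comp _ _ cGx (@continuous_enorm R n.+1 (G x))).
(* Otherwise [|G| < k] on [closure Om] near [y], whereas [grad_ge_near_boundary] finds points of
   [Om] arbitrarily close to [y] with gradient at least [k]. *)
have kG : k <= enorm (G y).
  rewrite leNgt; apply/negP => Gk.
  have hy := (subspace_continuousP _ _).1 cle y cly.
  have : \forall x \near within (closure Om) (nbhs y), enorm (G x) < k.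
    exact: cvgr_lt hy _ Gk.
  move=> /nbhs_eball[d d0 hd].
  have [x Omx [xd kx]] := grad_ge_near_boundary Om u c y e k d cu du e_gt0 yc eOm cly uy hk d0.
  have := hd x xd (subset_closure Omx); rewrite GE //; lra.
have k2 : k / 2 < enorm (G y) by lra.
have hy := (subspace_continuousP _ _).1 cle y cly.
have ny : nbhs y [set x | closure Om x -> k / 2 < enorm (G x)].
  exact: (cvgr_gt _ hy _ k2).
apply: filterS ny => x hx Omx.
by rewrite -GE //; apply: hx; exact: subset_closure.
Qed.
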